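(* The inverse zeta bijection $\zeta^{-1}\colon\mathcal D\to\mathcal D$ cannot be realised by any $\mathsf{WRP}$ map: there is no $\mathsf{WRP}$ map $T\colon\{U,D\}^*\rightharpoonup\{U,D\}^*$ with $\mathcal D\subseteq\operatorname{dom}(T)$ and $T(P)=\zeta^{-1}(P)$ for every $P\in\mathcal D$.
   Context: **Dyck paths.** A Dyck path of semilength $n$ is a word $P\in\{U,D\}^{2n}$ with $n$ letters $U$ and $n$ letters $D$ such that every prefix has at least as many $U$'s as $D$'s. $\mathcal D_n$ is the set of these, $\mathcal D=\bigcup_{n\ge0}\mathcal D_n$. For a word $w\in\{U,D\}^*$, $h_w(k)$ is the number of $U$'s minus the number of $D$'s among its first $k$ letters. If $P\in\mathcal D_n$ has its $U$'s at positions $p_1<\dots<p_n$, its area sequence is $(a_1,\dots,a_n)$ with $a_i=h_P(p_i-1)$. **Zeta map.** $\zeta(\varepsilon)=\varepsilon$. For $P\in\mathcal D_n$, $n\ge1$, with area sequence $(a_1,\dots,a_n)$, $\zeta(P)$ is the word produced as follows: for each level $r=0,1,\dots,\max_i a_i+1$ in turn, scan $a_1,\dots,a_n$ from left to right and at each $i$ append $U$ if $a_i=r$, append $D$ if $a_i=r-1$, and append nothing otherwise. It is a classical theorem that $\zeta$ restricts to a bijection $\mathcal D_n\to\mathcal D_n$ for every $n$; $\zeta^{-1}$ is its inverse. **MSO on words.** A word $w=a_1\cdots a_n$ over a finite alphabet $\Sigma$ is a structure with universe $\mathrm{Pos}(w)=\{1,\dots,n\}$, the order $<$, and unary predicates $P_a$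 ($a\in\Sigma$) with $P_a(i)$ iff $a_i=a$. MSO formulas are built from $x<y$, $x=y$, $P_a(x)$, $x\in X$ by Boolean connectives and quantification over positions and over sets of positions. $w\models\varphi(i_1,\dots,i_k)$ denotes satisfaction. **Polyregular presentations.** A polyregular presentation (input alphabet $\Sigma$, output alphabet $\Gamma$, both finite) consists of: a nonempty finite set $C$ of copy names, each $c\in C$ with an arity $k_c\ge1$; an MSO domain sentence $\varphi_{\mathrm{dom}}$; for each $c$ an MSO selection formula $\varphi_c(x_1,\dots,x_{k_c})$, giving the set of selected atoms $\mathrm{At}(w)=\{(c,\bar i):c\in C,\ \bar i\in\mathrm{Pos}(w)^{k_c},\ w\models\varphi_c(\bar i)\}$; for each $c$ and $\gamma\in\Gamma$ an MSO label formula $\psi_{c,\gamma}(x_1,\dots,x_{k_c})$ such that each selected atom $(c,\bar i)$ satisfies exactly one of them, that $\gamma$ being its label; and for each pair $c,c'\in C$ an MSO ordering formula $\chi_{c,c'}(\bar x,\bar y)$, such that on each $w$ these define a strict linear order $\chi$ on $\mathrm{At}(w)$. **Rank functions.** A $d$-dimensional deterministic additive rank source over $\Sigma$ is $A=(Q,q_0,\delta,\omega)$ with $Q$ a finite set, $q_0\in Q$, $\delta\colon Q\times\Sigma\to Q$, $\omega\colon Q\times\Sigma\to\mathbb Z^d$. On $w=a_1\cdots a_n$ put $q_i=\delta(q_{i-1},a_i)$; for $1\le i\le n+1$ the prefix rank is $\rho_A^w(i)=\sum_{j<i}\omega(q_{j-1},a_j)$, and $q^A_i:=q_{i-1}$ is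 the state just before position $i$. A $d$-dimensional prefix-additive rank function on $k$-tuples of positions is a function of the form $\kappa^w(x_1,\dots,x_k)=c_0+\sum_{r=1}^k\bigl(\rho_{A_r}^w(x_r)+\beta_r(q^{A_r}_{x_r},a_{x_r})\bigr)$, with $c_0\in\mathbb Z^d$ fixed, $A_r$ fixed $d$-dimensional rank sources with state sets $Q_r$, and $\beta_r\colon Q_r\times\Sigma\to\mathbb Z^d$ fixed tables. **WRP.** A $\mathsf{WRP}$ presentation is a polyregular presentation together with a fixed $d\ge0$ and, for each $c\in C$, a $d$-dimensional prefix-additive rank function $\kappa_c$ on $k_c$-tuples. Selected atoms are ordered by $(c,\bar i)\prec(c',\bar i')$ iff $\kappa_c^w(\bar i)<_{\mathrm{lex}}\kappa_{c'}^w(\bar i')$, or these vectors are equal and $(c,\bar i)$ precedes $(c',\bar i')$ in $\chi$. The associated partial map $T\colon\Sigma^*\rightharpoonup\Gamma^*$ has domain $\{w:w\models\varphi_{\mathrm{dom}}\}$, and $T(w)$ is the concatenation of the labels of the selected atoms in increasing $\prec$-order. $\mathsf{WRP}$ is the class of partial maps so obtained. *)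

(* Defs.v *)
From HB Require Import structures.
From mathcomp Require Import all_boot all_order all_algebra.

Set Implicit Arguments.
Unset Strict Implicit.
Unset Printing Implicit Defensive.

Import Order.TTheory GRing.Theory Num.Theory.
Local Open Scope ring_scope.

(* Positions of a word w are the elements of 'I_(size w), i.e., numbered from
   0: the letter at position i is the i.+1-st letter of w. *)

(** * Dyck paths and the zeta map *)

Variant letter := U | D.

Definition bool_of_letter (x : letter) : bool := if x is U then true else false.
Definition letter_of_bool (b : bool) : letter := if b then U else D.

Lemma bool_of_letterK : cancel bool_of_letter letter_of_bool.
Proof. by case. Qed.

HB.instance Definition _ := Finite.copy letter (can_type bool_of_letterK).

Definition height (w : seq letter) (k : nat) : int :=
  (count_mem U (take k w))%:Z - (count_mem D (take k w))%:Z.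

Definition dyck (w : seq letter) : bool :=
  (height w (size w) == 0) && [forall k : 'I_(size w).+1, 0 <= height w k].

(* The absolute value only serves to land in nat: all heights of a Dyck path
   are nonnegative. *)
Definition area_seq (P : seq letter) : seq nat :=
  [seq `|height P k|%N | k <- iota 0 (size P) & nth D P k == U].

Definition zeta_level (a : seq nat) (r : nat) : seq letter :=
  pmap (fun ai : nat => if ai == r then Some U
                        else if ai.+1 == r then Some D else None) a.

Definition zeta (P : seq letter) : seq letter :=
  let a := area_seq P in
  flatten [seq zeta_level a r | r <- iota 0 (\max_(ai <- a) ai).+2].

(* The Dyck path Q of the same size as P such that zeta Q = P. It exists and is
   unique when P is a Dyck path, so the default value [::] is then not used. *)
Definition zeta_inv (P : seq letter) : seq letter :=
  if [pick Q : (size P).-tuple letter | dyck Q && (zeta Q == P)] is Some Q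
  then val Q else [::].

(** * Monadic second-order logic on words *)

(* mso Sigma k m: formulas with free position variables among x_0 .. x_(k-1)
   and free set variables among X_0 .. X_(m-1). Variables are de Bruijn
   indices: a quantifier binds index 0 and shifts the other ones. *)
Inductive mso (Sigma : Type) : nat -> nat -> Type :=
| Lt k m of 'I_k & 'I_k : mso Sigma k m
| Eq k m of 'I_k & 'I_k : mso Sigma k m
| Letter k m of Sigma & 'I_k : mso Sigma k m
| Mem k m of 'I_k & 'I_m : mso Sigma k m
| Not k m of mso Sigma k m : mso Sigma k m
| And k m of mso Sigma k m & mso Sigma k m : mso Sigma k m
| Or k m of mso Sigma k m & mso Sigma k m : mso Sigma k m
| Ex1 k m of mso Sigma k.+1 m : mso Sigma k m
| All1 k m of mso Sigma k.+1 m : mso Sigma k m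
| Ex2 k m of mso Sigma k m.+1 : mso Sigma k m
| All2 k m of mso Sigma k m.+1 : mso Sigma k m.

Fixpoint sat (Sigma : eqType) (w : seq Sigma) k m (phi : mso Sigma k m) :
    k.-tuple 'I_(size w) -> m.-tuple {set 'I_(size w)} -> bool :=
  match phi with
  | Lt _ _ x y => fun e _ => (tnth e x < tnth e y)%N
  | Eq _ _ x y => fun e _ => tnth e x == tnth e y
  | Letter _ _ a x => fun e _ => tnth (in_tuple w) (tnth e x) == a
  | Mem _ _ x X => fun e E => tnth e x \in tnth E X
  | Not _ _ f => fun e E => ~~ sat f e E
  | And _ _ f g => fun e E => sat f e E && sat g e E
  | Or _ _ f g => fun e E => sat f e E || sat g e E
  | Ex1 _ _ f => fun e E => [exists x, sat f [tuple of x :: e] E]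
  | All1 _ _ f => fun e E => [forall x, sat f [tuple of x :: e] E]
  | Ex2 _ _ f => fun e E => [exists X, sat f e [tuple of X :: E]]
  | All2 _ _ f => fun e E => [forall X, sat f e [tuple of X :: E]]
  end.

Definition models (Sigma : eqType) (w : seq Sigma) k (phi : mso Sigma k 0)
  (x : k.-tuple 'I_(size w)) : bool := sat phi x [tuple].
Arguments models {Sigma} w {k} phi x.

(** * Polyregular presentations *)

Record polyreg_data (Sigma Gamma : finType) := PolyregData {
  copy : finType;
  arity : copy -> nat;
  dom_formula : mso Sigma 0 0;
  sel_formula : forall c, mso Sigma (arity c) 0;
  label_formula : forall c, Gamma -> mso Sigma (arity c) 0;
  (* The first arity c variables form the first tuple, the others the second. *)
  order_formula : forall c c', mso Sigma (arity c + arity c') 0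
}.

Section PolyregData.
Variables (Sigma Gamma : finType) (p : polyreg_data Sigma Gamma).
Variable w : seq Sigma.

Definition atom := {c : copy p & (arity c).-tuple 'I_(size w)}.

Definition selected : pred atom :=
  fun a => models w (sel_formula (tag a)) (tagged a).

Definition has_label (a : atom) (g : Gamma) : bool :=
  models w (label_formula (tag a) g) (tagged a).

Definition chi (a b : atom) : bool :=
  models w (order_formula (tag a) (tag b)) [tuple of tagged a ++ tagged b].

End PolyregData.

Record polyregular (Sigma Gamma : finType) := Polyregular {
  pr_data :> polyreg_data Sigma Gamma;
  copy_nonempty : (0 < #|copy pr_data|)%N;
  arity_gt0 : forall c : copy pr_data, (0 < arity c)%N;
  label_unique : forall (w : seq Sigma) (a : atom pr_data w),
    selected a -> exists! g : Gamma, has_label a g;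
  chi_irr : forall w : seq Sigma,
    {in @selected _ _ pr_data w, irreflexive (@chi _ _ pr_data w)};
  chi_trans : forall w : seq Sigma,
    {in @selected _ _ pr_data w & &, transitive (@chi _ _ pr_data w)};
  chi_total : forall w : seq Sigma,
    {in @selected _ _ pr_data w &, forall a b, a != b -> chi a b || chi b a}
}.

(** * Rank functions *)

Record rank_source (Sigma : finType) (d : nat) := RankSource {
  rs_state : finType;
  rs_init : rs_state;
  rs_step : rs_state -> Sigma -> rs_state;
  rs_weight : rs_state -> Sigma -> 'rV[int]_d
}.

Definition state_before (Sigma : finType) d (A : rank_source Sigma d)
    (w : seq Sigma) (i : nat) : rs_state A :=
  foldl (@rs_step _ _ A) (rs_init A) (take i w).

Definition prefix_rank (Sigma : finType) d (A : rank_source Sigma d)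
    (w : seq Sigma) (i : nat) : 'rV[int]_d :=
  \sum_(j < size w | (j < i)%N)
    rs_weight (state_before A w j) (tnth (in_tuple w) j).

Record rank_function (Sigma : finType) (d k : nat) := RankFunction {
  rf_const : 'rV[int]_d;
  rf_source : 'I_k -> rank_source Sigma d;
  rf_table : forall r : 'I_k, rs_state (rf_source r) -> Sigma -> 'rV[int]_d
}.

Definition rank_eval (Sigma : finType) d k (kappa : rank_function Sigma d k)
    (w : seq Sigma) (x : k.-tuple 'I_(size w)) : 'rV[int]_d :=
  rf_const kappa +
  \sum_(r < k)
    (prefix_rank (rf_source kappa r) w (tnth x r) +
     rf_table (state_before (rf_source kappa r) w (tnth x r))
              (tnth (in_tuple w) (tnth x r))).

Definition lex_lt d (u v : 'rV[int]_d) : bool :=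
  (([tuple u 0 i | i < d] : d.-tuplelexi int) < [tuple v 0 i | i < d])%O.

(** * WRP *)

Record wrp_presentation (Sigma Gamma : finType) := WRPPresentation {
  wrp_poly :> polyregular Sigma Gamma;
  wrp_dim : nat;
  wrp_rank : forall c : copy wrp_poly, rank_function Sigma wrp_dim (arity c)
}.

Section WRPMap.
Variables (Sigma Gamma : finType) (p : wrp_presentation Sigma Gamma).
Variable w : seq Sigma.

Definition atom_rank (a : atom p w) : 'rV[int]_(wrp_dim p) :=
  rank_eval (wrp_rank (tag a)) (tagged a).

Definition atom_lt (a b : atom p w) : bool :=
  lex_lt (atom_rank a) (atom_rank b)
  || (atom_rank a == atom_rank b) && chi a b.

Definition sorted_atoms : seq (atom p w) :=
  sort (fun a b => (a == b) || atom_lt a b) (enum (@selected _ _ p w)).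

(* Each selected atom has exactly one label, so pmap discards nothing. *)
Definition wrp_output : seq Gamma :=
  pmap (fun a => [pick g | has_label a g]) sorted_atoms.

Definition wrp_map : option (seq Gamma) :=
  if models w (dom_formula p) [tuple] then Some wrp_output else None.

End WRPMap.

(* A partial map is a function to option; None means undefined. *)
Definition WRP (Sigma Gamma : finType) (T : seq Sigma -> option (seq Gamma)) :
    Prop :=
  exists p : wrp_presentation Sigma Gamma, forall w, T w = wrp_map p w.

(* Main.v *)
From HB Require Import structures.
Require Import Defs.
From mathcomp Require Import all_boot all_order all_algebra.
From mathcomp Require Import zify.

(** Areas separate the two sides: the area of the image under zeta^-1 is a
    sequential quantity, while the area of the output of a WRP map only
    involves boundedly many places of the input at a time.

    Write a Dyck path as P = U^f(0) D U^(f(1)-f(0)) D ..., where f(j) is the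
    number of letters U before the letter D number j, counting from 0. Read as
    the record of a queue, P describes an ordered forest whose nodes 0, 1, ...
    are numbered in breadth-first order, the children of node j being
    f(j), ..., f(j+1)-1; and zeta^-1(P) is the contour of this forest in
    depth-first order, because the scan of level r in the definition of zeta
    lists each node of depth r-1 followed by its children
    (zeta_zeta_preimage, zeta_invE). Its area, a sum of depths, is therefore
    governed by the orbit of 0 under f, that is, by the bounce path of P: it is
    n(n+1) minus the sum of f^r(0) for 1 <= r <= n+1
    (area_stat_zeta_preimage).

    The area of a word is also the number of pairs of letters U minus the
    number of pairs with a D before a U. For the output of a WRP map this is a
    sum over pairs of atoms (area_stat_output), and the contribution of a pair
    depends on MSO formulas and prefix ranks at its positions. Let u and v have
    the same length and act in the same way on all automata and rank sources of
    the presentation, weights included. Exchanging u and v in the input then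
    does not affect the pairs without a position inside the exchanged factor.
    Hence, in an input with m blocks that are filled with u or v according to m
    bits, m exceeding the number of positions of a pair of atoms, the area of
    the output is a sum of functions that each ignore one of the bits, and its
    alternating sum over the Boolean cube vanishes (alt_area_stat_output).
    Suitable u and v exist among the 2^n products of n factors UD and DU, since
    finitely many states and linearly growing weights leave only polynomially
    many behaviours (pigeonhole_indist).

    Whatever these u and v are, they differ in some factor number t, so that
    f takes values differing by 1 there. The rest of the path can be designed
    so that the orbit of 0 reaches this very letter of a block if all earlier
    bits are true, and jumps over the block otherwise (orbit_block, orbit_gap).
    The end of the orbit then depends on the conjunction of all bits, whose
    alternating sum does not vanish (alt_area_stat_family). *)

Set Implicit Arguments.
Unset Strict Implicit.
Unset Printing Implicit Defensive.

Import Order.TTheory GRing.Theory Num.Theory.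
Local Open Scope ring_scope.

(** * Alternating sums over the Boolean cube *)

(** Up to sign, the sum of (-1)^|x| F x over the words x of length m. The
    recursion on the last bit is what the family of Dyck paths below needs. *)
Fixpoint alt_sum (m : nat) (F : seq bool -> int) : int :=
  if m is m'.+1
  then alt_sum m' (fun x => F (rcons x true) - F (rcons x false)) else F [::].

Lemma eq_alt_sum m F G :
  (forall x, size x = m -> F x = G x) -> alt_sum m F = alt_sum m G.
Proof.
elim: m F G => [|m IHm] F G eqFG /=; first exact: eqFG.
by apply: IHm => x sz_x; rewrite !eqFG ?size_rcons ?sz_x.
Qed.

Lemma alt_sum_sum (I : finType) m (F : I -> seq bool -> int) :
  alt_sum m (fun x => \sum_i F i x) = \sum_i alt_sum m (F i).
Proof.
elim: m F => [|m IHm] F //=; rewrite -IHm; apply: eq_alt_sum => x _.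
by rewrite sumrB.
Qed.

Lemma alt_sum0 m : alt_sum m (fun=> 0) = 0.
Proof.
by elim: m => //= m IHm; rewrite -[RHS]IHm; apply: eq_alt_sum => x; rewrite subr0.
Qed.

(** The two values of the ignored bit cancel. *)
Lemma alt_sum_indep m i F :
  (i < m)%N ->
  (forall x y, size x = i -> (size x + size y).+1 = m ->
     F (x ++ true :: y) = F (x ++ false :: y)) ->
  alt_sum m F = 0.
Proof.
elim: m i F => [|m IHm] i F //= lt_im indepF.
have [lt_im'|eq_im] : (i < m)%N \/ i = m by lia.
  apply: (IHm _ _ lt_im') => x y sz_x sz_xy.
  by rewrite !rcons_cat !rcons_cons !(indepF x (rcons y _)) // size_rcons addnS sz_xy.
rewrite -[RHS](alt_sum0 m); apply: eq_alt_sum => x sz_x.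
rewrite -!cats1 indepF ?subrr //=; lia.
Qed.

Lemma alt_sum_all_true m F :
  (forall x, size x = m -> x <> nseq m true -> F x = 0) ->
  alt_sum m F = F (nseq m true).
Proof.
elim: m F => [|m IHm] F //= F0.
have ntrue : true :: nseq m true = rcons (nseq m true) true.
  by elim: m {IHm F0} => //= m <-.
have F_false x : size x = m -> F (rcons x false) = 0.
  move=> sz_x; apply: F0; first by rewrite size_rcons sz_x.
  by rewrite ntrue => /rcons_inj[].
rewrite IHm => [|x sz_x nt_x]; first by rewrite F_false ?size_nseq // subr0 ntrue.
rewrite F_false // F0 ?subr0 ?size_rcons ?sz_x // ntrue.
by move/rcons_inj=> [].
Qed.

(** * From MSO formulas to finite automata *)

(** The alphabet is arbitrary: the automaton of a formula with free variables
    reads letters decorated with unboundedly many marks, and only finiteness of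
    the state set is used later. *)
Record automaton (S : Type) := Automaton {
  state : finType;
  init : state;
  step : state -> S -> state;
  final : pred state
}.

Definition accepts (S : Type) (A : automaton S) (s : seq S) : bool :=
  final (foldl (@step S A) (init A) s).

Arguments accepts {S} A s : simpl never.

Definition marked (Sigma : Type) : Type := (Sigma * seq bool * seq bool)%type.

(** The word w, whose first letter has position i, where each letter also says
    which variables of e are interpreted by its position and which variables
    of E contain it. Valuations are sequences of naturals, so that words of the
    same length can share them. *)
Fixpoint mark (Sigma : Type) (i : nat) (w : seq Sigma) (e : seq nat)
    (E : seq (seq nat)) : seq (marked Sigma) :=
  if w is x :: w'
  then (x, [seq y == i | y <- e], [seq i \in X | X <- E]) :: mark i.+1 w' e E
  else [::].

Section Mark.
Variable Sigma : Type.
Implicit Types (w : seq Sigma) (e : seq nat) (E : seq (seq nat)).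

Lemma size_mark i w e E : size (mark i w e E) = size w.
Proof. by elim: w i => //= x w IHw i; rewrite IHw. Qed.

Lemma mark_cat i w1 w2 e E :
  mark i (w1 ++ w2) e E = mark i w1 e E ++ mark (i + size w1) w2 e E.
Proof. by elim: w1 i => [|x w1 IHw] i /=; rewrite ?addn0 // IHw addSnnS. Qed.

Lemma mark_unmarked i w e :
  all (fun y => (y < i) || (i + size w <= y))%N e ->
  mark i w e [::] = [seq (x, nseq (size e) false, [::]) | x <- w].
Proof.
elim: w i => //= x w IHw i e_out; rewrite IHw; last first.
  by apply: sub_all e_out => y; lia.
congr ((_, _, _) :: _); elim: e e_out {IHw} => //= y e IHe /andP[y_out /IHe->].
by congr (_ :: _); apply/eqP; lia.
Qed.

Definition add_pos_mark (b : bool) (l : marked Sigma) : marked Sigma :=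
  (l.1.1, b :: l.1.2, l.2).
Definition add_set_mark (b : bool) (l : marked Sigma) : marked Sigma :=
  (l.1.1, l.1.2, b :: l.2).

Lemma mark_cons_pos i w y e E :
  mark i w (y :: e) E =
  [seq add_pos_mark bl.1 bl.2
     | bl <- zip [seq y == j | j <- iota i (size w)] (mark i w e E)].
Proof. by elim: w i => //= x w IHw i; rewrite IHw. Qed.

Lemma mark_cons_set i w e X E :
  mark i w e (X :: E) =
  [seq add_set_mark bl.1 bl.2
     | bl <- zip [seq j \in X | j <- iota i (size w)] (mark i w e E)].
Proof. by elim: w i => //= x w IHw i; rewrite IHw. Qed.

Lemma take_markS w e E x0 i : (i < size w)%N ->
  take i.+1 (mark 0 w e E) =
  rcons (take i (mark 0 w e E))
    (nth x0 w i, [seq y == i | y <- e], [seq i \in X | X <- E]).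
Proof.
move=> lt_iw; rewrite (take_nth (x0, [::], [::])) ?size_mark //; congr rcons.
suff nth_mark j : nth (x0, [::], [::]) (mark j w e E) i =
    (nth x0 w i, [seq y == j + i | y <- e], [seq j + i \in X | X <- E])%N.
  by rewrite nth_mark.
elim: w j i lt_iw => //= x w IHw j [|i] lt_iw; first by rewrite addn0.
by rewrite /= IHw // addSnnS.
Qed.

End Mark.

Section Automata.
Variable S : Type.

Definition test_aut (at_pos T : pred S) : automaton S :=
  Automaton false (fun q l => q || at_pos l && T l) id.

Definition before_aut (at_x at_y : pred S) : automaton S :=
  Automaton (false, false)
    (fun q l => (q.1 || at_x l, q.2 || q.1 && at_y l)) (fun q => q.2).

Definition not_aut (A : automaton S) : automaton S :=
  Automaton (init A) (@step S A) (fun q => ~~ final q).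

Definition pair_aut (op : bool -> bool -> bool) (A B : automaton S) :
    automaton S :=
  Automaton (init A, init B) (fun q l => (step q.1 l, step q.2 l))
    (fun q => op (final q.1) (final q.2)).

(** Projection: the subset construction for an automaton that guesses one bit
    along with each letter that it reads. *)
Definition guess_aut (Q : finType) (q0 : Q) (delta : Q -> bool -> S -> Q)
    (F : pred Q) : automaton S :=
  Automaton [set q0]
    (fun (R : {set Q}) l => [set r | [exists q in R, exists b, r == delta q b l]])
    (fun R => [exists q in R, F q]).

Lemma pair_aut_accepts op A B s :
  accepts (pair_aut op A B) s = op (accepts A s) (accepts B s).
Proof.
rewrite /accepts /=; set q := foldl _ _ _.
suff ->: q = (foldl (@step S A) (init A) s, foldl (@step S B) (init B) s) by [].
by rewrite {}/q; elim: s (init A) (init B) => //= x s IHs a b; rewrite IHs.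
Qed.

Lemma guess_aut_run (Q : finType) (q0 : Q) delta F (R : {set Q}) s q :
  q \in foldl (@step S (guess_aut q0 delta F)) R s <->
  exists r : Q, exists bs : seq bool, [/\ r \in R, size bs = size s &
    q = foldl (fun q bl => delta q bl.1 bl.2) r (zip bs s)].
Proof.
elim: s R => [|l s IHs] R /=; split.
- by move=> Rq; exists q, [::].
- by case=> r [[|? ?] []] //= ? _ ->.
- case/IHs=> r [bs [+ sz_bs def_q]]; rewrite inE.
  case/existsP=> r0 /andP[Rr0 /existsP[b /eqP def_r]].
  by exists r0, (b :: bs); rewrite /= sz_bs -def_r.
case=> r [[|b bs] []] //= Rr [sz_bs] def_q.
apply/IHs; exists (delta r b l), bs; split=> //; rewrite inE.
by apply/existsP; exists r; rewrite Rr; apply/existsP; exists b.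
Qed.

Lemma guess_aut_accepts (Q : finType) (q0 : Q) delta F s :
  accepts (guess_aut q0 delta F) s <->
  exists bs : seq bool, size bs = size s /\
    F (foldl (fun q bl => delta q bl.1 bl.2) q0 (zip bs s)).
Proof.
split.
  case/existsP=> q /andP[/guess_aut_run[r [bs [/set1P-> sz_bs ->]]] Fq].
  by exists bs.
case=> bs [sz_bs Fq]; apply/existsP; eexists; apply/andP; split; last exact: Fq.
by apply/guess_aut_run; exists q0, bs; rewrite set11.
Qed.

End Automata.

Section MsoAutomaton.
Variable Sigma : eqType.
Implicit Types (w : seq Sigma).

Definition at_var (x : nat) : pred (marked Sigma) := fun l => nth false l.1.2 x.

(** The guessed bits must mark exactly one position: the two Booleans record
    whether a first and a second marked position have been met. *)
Definition ex_pos_aut (A : automaton (marked Sigma)) : automaton (marked Sigma) :=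
  guess_aut (init A, (false, false))
    (fun q b l => (step q.1 (add_pos_mark b l),
                   (q.2.1 || b, q.2.2 || q.2.1 && b)))
    (fun q => [&& final q.1, q.2.1 & ~~ q.2.2]).

Definition ex_set_aut (A : automaton (marked Sigma)) : automaton (marked Sigma) :=
  guess_aut (init A) (fun q b l => step q (add_set_mark b l)) (@final _ A).

Fixpoint mso_aut k m (phi : mso Sigma k m) : automaton (marked Sigma) :=
  match phi with
  | Lt _ _ x y => before_aut (at_var x) (at_var y)
  | Eq _ _ x y => test_aut (at_var x) (at_var y)
  | Letter _ _ a x => test_aut (at_var x) (fun l => l.1.1 == a)
  | Defs.Mem _ _ x X => test_aut (at_var x) (fun l => nth false l.2 X)
  | Not _ _ f => not_aut (mso_aut f)
  | And _ _ f g => pair_aut andb (mso_aut f) (mso_aut g)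
  | Or _ _ f g => pair_aut orb (mso_aut f) (mso_aut g)
  | Ex1 _ _ f => ex_pos_aut (mso_aut f)
  | All1 _ _ f => not_aut (ex_pos_aut (not_aut (mso_aut f)))
  | Ex2 _ _ f => ex_set_aut (mso_aut f)
  | All2 _ _ f => not_aut (ex_set_aut (not_aut (mso_aut f)))
  end.

Definition pos_val n k (e : k.-tuple 'I_n) : seq nat := map val e.
Definition set_val n m (E : m.-tuple {set 'I_n}) : seq (seq nat) :=
  [seq map val (enum (X : {set 'I_n})) | X <- E].

Lemma mem_set_val n (X : {set 'I_n}) (i : 'I_n) :
  ((i : nat) \in map val (enum X)) = (i \in X).
Proof. by rewrite mem_map ?mem_enum //; apply: val_inj. Qed.

Section Valuation.
Variables (w : seq Sigma) (k m : nat).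
Variables (e : k.-tuple 'I_(size w)) (E : m.-tuple {set 'I_(size w)}).
Let s := mark 0 w (pos_val e) (set_val E).

Lemma nth_at_var (x : 'I_k) (i : nat) :
  nth false [seq y == i | y <- pos_val e] x = (tnth e x == i :> nat).
Proof.
rewrite (nth_map 0%N) ?size_map ?size_tuple // (nth_map (tnth e x)) ?size_tuple //.
by rewrite -tnth_nth.
Qed.

Lemma test_aut_mark (x : 'I_k) T :
  accepts (test_aut (at_var x) T) s =
  T (tnth (in_tuple w) (tnth e x), [seq y == val (tnth e x) | y <- pos_val e],
     [seq val (tnth e x) \in X | X <- set_val E]).
Proof.
set Tx := T _; set p := tnth e x; have x0 := tnth (in_tuple w) p.
suff run i : (i <= size w)%N ->
    foldl (@step _ (test_aut (at_var x) T)) false (take i s) = (p < i)%N && Tx.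
  have := run _ (leqnn _); rewrite take_oversize ?size_mark // /accepts => ->.
  by rewrite ltn_ord.
elim: i => [|i IHi] lt_iw; first by rewrite take0.
rewrite (take_markS _ _ x0) // -cats1 foldl_cat (IHi (ltnW lt_iw)) /= /at_var /= nth_at_var.
rewrite -/p ltnS [(p <= i)%N]leq_eqVlt; case: (eqVneq (p : nat) i) => /= [eq_pi|].
  by rewrite -eq_pi ltnn /= /Tx (tnth_nth x0).
by rewrite orbF.
Qed.

Lemma before_aut_mark (x y : 'I_k) :
  accepts (before_aut (at_var x) (at_var y)) s = (tnth e x < tnth e y)%N.
Proof.
set p := tnth e x; set q := tnth e y; have x0 := tnth (in_tuple w) p.
suff run i : (i <= size w)%N ->
    foldl (@step _ (before_aut (at_var x) (at_var y))) (false, false) (take i s) =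
    (p < i, p < q < i)%N.
  have := run _ (leqnn _); rewrite take_oversize ?size_mark // /accepts => ->.
  by rewrite /= ltn_ord andbT.
elim: i => [|i IHi] lt_iw; first by rewrite take0 ltn0 !andbF.
rewrite (take_markS _ _ x0) // -cats1 foldl_cat (IHi (ltnW lt_iw)) /= /at_var /=.
by rewrite !nth_at_var -/p -/q; congr (_, _); lia.
Qed.

End Valuation.

Lemma ex_pos_aut_mark w k m (e : k.-tuple 'I_(size w))
    (E : m.-tuple {set 'I_(size w)}) (A : automaton (marked Sigma)) :
  accepts (ex_pos_aut A) (mark 0 w (pos_val e) (set_val E)) =
  [exists x, accepts A (mark 0 w (pos_val [tuple of x :: e]) (set_val E))].
Proof.
set s := mark _ _ _ _; pose n := size w.
have run (bs : seq bool) q c : size bs = size s ->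
    foldl (fun q bl => (step q.1 (add_pos_mark bl.1 bl.2),
                        (q.2.1 || bl.1, q.2.2 || q.2.1 && bl.1)))
      (q, c) (zip bs s) =
    (foldl (@step _ A) q [seq add_pos_mark bl.1 bl.2 | bl <- zip bs s],
     foldl (fun c b => (c.1 || b, c.2 || c.1 && b)) c bs).
  by elim: bs s q c => [|b bs IHbs] [|l s'] //= q c [/IHbs->].
have once (bs : seq bool) :
    let c := foldl (fun c b => (c.1 || b, c.2 || c.1 && b)) (false, false) bs in
    c.1 && ~~ c.2 = (count id bs == 1)%N.
  suff count_run c : foldl (fun c b => (c.1 || b, c.2 || c.1 && b)) c bs =
      (c.1 || (0 < count id bs), c.2 || (1 < c.1 + count id bs))%N.
    by rewrite count_run /=; lia.
  elim: bs c => [|b bs IHbs] [c1 c2] /=; last by rewrite IHbs /=; congr (_, _); lia.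
  by rewrite orbF; congr (_, _); lia.
apply/idP/existsP => [/guess_aut_accepts[bs [sz_bs]]|[x Ax]].
  rewrite run //= once => /andP[Aq bs1].
  have lt_ib : (index true bs < n)%N.
    have: has id bs by rewrite has_count (eqP bs1).
    have ->: has id bs = (true \in bs).
      by rewrite -has_pred1; apply: eq_has => -[].
    by rewrite -index_mem sz_bs size_mark.
  exists (Ordinal lt_ib); rewrite /accepts /= mark_cons_pos /=.
  suff ->: [seq index true bs == j | j <- iota 0 (size w)] = bs by [].
  have sz_bsn : size bs = size w by rewrite sz_bs size_mark.
  apply: (@eq_from_nth _ false) => [|i]; first by rewrite size_map size_iota.
  rewrite size_map size_iota => lt_iw.
  rewrite (nth_map 0%N) ?size_iota // nth_iota // add0n.
  rewrite -sz_bsn in lt_iw; clear -bs1 lt_iw.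
  elim: bs i bs1 lt_iw => //= -[] bs IHbs [|i] //=; last first.
    by rewrite add0n eqSS => bs1; rewrite ltnS; apply: IHbs.
  rewrite eqSS -leqn0 leqNgt -has_count => /hasPn no_b.
  rewrite ltnS => lt_i.
  by symmetry; apply/negbTE; apply: (no_b (nth false bs i)); apply: mem_nth.
apply/guess_aut_accepts.
exists [seq val x == j | j <- iota 0 (size w)].
have sz_b : size [seq val x == j | j <- iota 0 (size w)] = size s.
  by rewrite size_mark size_map size_iota.
split=> //; rewrite run //= once; apply/andP; split.
  by move: Ax; rewrite /accepts mark_cons_pos.
rewrite count_map (eq_count (a2 := pred1 (val x))).
  by rewrite count_uniq_mem ?iota_uniq // mem_iota ltn_ord.
by move=> j; rewrite /= eq_sym.
Qed.

Lemma ex_set_aut_mark w k m (e : k.-tuple 'I_(size w))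
    (E : m.-tuple {set 'I_(size w)}) (A : automaton (marked Sigma)) :
  accepts (ex_set_aut A) (mark 0 w (pos_val e) (set_val E)) =
  [exists X, accepts A (mark 0 w (pos_val e) (set_val [tuple of X :: E]))].
Proof.
set s := mark _ _ _ _.
have run (bs : seq bool) q : size bs = size s ->
    foldl (fun q bl => step q (add_set_mark bl.1 bl.2)) q (zip bs s) =
    foldl (@step _ A) q [seq add_set_mark bl.1 bl.2 | bl <- zip bs s].
  by elim: bs s q => [|b bs IHbs] [|l s'] //= q [/IHbs->].
apply/idP/existsP => [/guess_aut_accepts[bs [sz_bs]]|[X AX]].
  rewrite run // => Aq; exists [set i : 'I_(size w) | nth false bs i].
  rewrite /accepts /set_val /= mark_cons_set.
  set bs' := map _ (iota _ _); suff ->: bs' = bs by [].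
  have sz_bsn : size bs = size w by rewrite sz_bs size_mark.
  apply: (@eq_from_nth _ false) => [|i]; first by rewrite size_map size_iota.
  rewrite size_map size_iota => lt_iw.
  rewrite (nth_map 0%N) ?size_iota // nth_iota // add0n.
  by rewrite (mem_set_val _ (Ordinal lt_iw)) inE.
apply/guess_aut_accepts.
exists [seq j \in map val (enum X) | j <- iota 0 (size w)].
have sz_b : size [seq j \in map val (enum X) | j <- iota 0 (size w)] = size s.
  by rewrite size_mark size_map size_iota.
by split=> //; rewrite run //; move: AX; rewrite /accepts /set_val /= mark_cons_set.
Qed.

(** Buechi's theorem, in the direction from formulas to automata; a quantifier
    is a projection of the marked word. *)
Theorem mso_autP w k m (phi : mso Sigma k m) (e : k.-tuple 'I_(size w))
    (E : m.-tuple {set 'I_(size w)}) :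
  sat phi e E = accepts (mso_aut phi) (mark 0 w (pos_val e) (set_val E)).
Proof.
elim: phi e E => {k m} /= k m.
- by move=> x y e E; rewrite before_aut_mark.
- by move=> x y e E; rewrite test_aut_mark /at_var nth_at_var eq_sym.
- by move=> a x e E; rewrite test_aut_mark.
- move=> x X e E; rewrite test_aut_mark /= (nth_map [::]) ?size_map ?size_tuple //.
  by rewrite (nth_map set0) ?size_tuple // mem_set_val -tnth_nth.
- by move=> f IHf e E; rewrite IHf.
- by move=> f IHf g IHg e E; rewrite pair_aut_accepts IHf IHg.
- by move=> f IHf g IHg e E; rewrite pair_aut_accepts IHf IHg.
- by move=> f IHf e E; rewrite ex_pos_aut_mark; apply: eq_existsb => x.
- move=> f IHf e E; rewrite [RHS](congr1 negb (ex_pos_aut_mark _ _ _)).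
  by rewrite negb_exists; apply: eq_forallb => x; rewrite negbK IHf.
- by move=> f IHf e E; rewrite ex_set_aut_mark; apply: eq_existsb => X.
move=> f IHf e E; rewrite [RHS](congr1 negb (ex_set_aut_mark _ _ _)).
by rewrite negb_exists; apply: eq_forallb => X; rewrite negbK IHf.
Qed.

End MsoAutomaton.

(** * Words that finitely many weighted machines cannot tell apart *)

Record machine (S : Type) := Machine {
  mstate : finType;
  mstep : mstate -> S -> mstate;
  mweight : mstate -> S -> int
}.

Section Machine.
Variables (S : Type) (M : machine S).

Fixpoint weight (q : mstate M) (s : seq S) : int :=
  if s is x :: s' then mweight q x + weight (mstep q x) s' else 0.

Lemma weight_cat q s t :
  weight q (s ++ t) = weight q s + weight (foldl (@mstep S M) q s) t.
Proof. by elim: s q => [|x s IHs] q /=; rewrite ?add0r // IHs addrA. Qed.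

(** Being equal from all states makes the relation compatible with contexts. *)
Definition indist (s t : seq S) : Prop :=
  forall q : mstate M,
    foldl (@mstep S M) q s = foldl (@mstep S M) q t /\ weight q s = weight q t.

End Machine.

Lemma exp2_dominates C d : exists n, ((C * n.+1 + 1) ^ d < 2 ^ n)%N.
Proof.
(* With n = 4K, 2^n is at least (2K+1)^2, hence at least K(n+1), which bounds
   the base of the power when the exponent is (d+1)n. *)
pose K := (C * d.+1 + 1)%N; pose q := (K + K)%N; pose n := (q + q)%N.
have le_n : (K * n.+1 <= 2 ^ n)%N.
  have := ltn_expl q (ltnSn 1); rewrite /n expnD => lt_q.
  by apply: leq_trans (leq_mul lt_q lt_q); rewrite /q; nia.
have n_gt0 : (0 < n)%N by rewrite /n /q /K; lia.
exists (d.+1 * n)%N; apply: (@leq_ltn_trans (2 ^ (n * d))).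
  rewrite expnM; have [->|d_gt0] := posnP d; first by rewrite !expn0.
  rewrite leq_exp2r //; apply: leq_trans le_n; rewrite /K; nia.
by rewrite ltn_exp2l // mulSn; lia.
Qed.

(** A word of n letters takes a bounded number of states and a weight that is
    at most linear in n, so that polynomially many behaviours are available to
    the 2^n words coded by n bits. *)
Lemma pigeonhole_indist (S : finType) (J : finType) (M : J -> machine S)
    (code : bool -> seq S) :
  (forall b, size (code b) = 2) ->
  exists n, exists g g' : n.-tuple bool, g != g' /\
    forall j, indist (M j) (flatten (map code g)) (flatten (map code g')).
Proof.
move=> sz_code; pose cd (g : seq bool) := flatten (map code g).
have size_cd g : size (cd g) = (size g).*2.
  by elim: g => //= b g IHg; rewrite size_cat sz_code IHg.
pose I : finType := {j : J & mstate (M j)}.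
pose c := (\sum_(j : J) \sum_(q : mstate (M j)) \sum_(x : S) `|mweight q x|)%N.
pose st := (\sum_(j : J) #|mstate (M j)|)%N.
have c_ge j (q : mstate (M j)) x : (`|mweight q x| <= c)%N.
  rewrite /c (bigD1 j) //= (bigD1 q) //= (bigD1 x) //=; lia.
have weight_le j (q : mstate (M j)) s : (`|weight q s| <= c * size s)%N.
  elim: s q => //= x s IHs q; rewrite mulnS.
  by apply: leq_trans (leq_add (c_ge j q x) (IHs (mstep q x))); lia.
have st_gt j (q : mstate (M j)) : (enum_rank q < st)%N.
  by apply: leq_trans (ltn_ord _) _; rewrite /st (bigD1 j) //= leq_addr.
have [n lt_n] := exp2_dominates (st + 4 * c) (#|I| + #|I|).
pose B := ((st + 4 * c) * n.+1)%N.
(* Weights are shifted by their bound, so that they become naturals. *)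
pose shifted (j : J) (q : mstate (M j)) (g : seq bool) : nat :=
  absz (weight q (cd g) + (2 * c * n)%N%:Z).
pose f (g : n.-tuple bool) : {ffun I -> 'I_B.+1} * {ffun I -> 'I_B.+1} :=
  ([ffun i : I => inord (enum_rank (foldl (@mstep S (M (tag i))) (tagged i) (cd g)))],
   [ffun i : I => inord (shifted _ (tagged i) g)]).
have : ~~ injectiveb f.
  apply/negP => /injectiveP /leq_card; rewrite card_tuple card_bool card_prod.
  rewrite !card_ffun card_ord -expnD leqNgt.
  by move: lt_n; rewrite addn1 => ->.
case/injectivePn => g [g' neq_gg' [/ffunP eq_st /ffunP eq_wt]].
exists n, g, g'; split=> // j q; split.
  have := eq_st (Tagged (fun j => mstate (M j)) q); rewrite !ffunE /=.
  move/(congr1 val); rewrite /= !inordK; first by move/val_inj/enum_rank_inj.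
    by apply: leq_trans (st_gt _ _) _; rewrite /B; nia.
  by apply: leq_trans (st_gt _ _) _; rewrite /B; nia.
have := eq_wt (Tagged (fun j => mstate (M j)) q); rewrite !ffunE /=.
move/(congr1 val); rewrite /= /shifted.
have:= weight_le j q (cd g); have := weight_le j q (cd g').
rewrite -/(cd g) -/(cd g') !size_cd !size_tuple.
move: (weight q _) (weight q (cd g')) => a a' le_a' le_a.
have le_B: (c * n.*2 + 2 * c * n <= B)%N by rewrite /B; nia.
have {}le_a' : (`|a'| <= 2 * c * n)%N by nia.
have {}le_a : (`|a| <= 2 * c * n)%N by nia.
have {}le_B : (2 * c * n + 2 * c * n <= B)%N by nia.
rewrite !inordK; move: le_B le_a le_a'; move: (2 * c * n)%N {f eq_st eq_wt} B => N B'.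
- by lia.
- by lia.
- by lia.
Qed.

(** * The sum of the heights of an output is a sum over pairs of atoms *)

Definition slope (x : letter) : int := if x is U then 1 else -1.

Definition num (x : letter) (w : seq letter) : nat := count_mem x w.
Arguments num : simpl never.

(** The sum, over the letters U of w, of the height before that letter; here
    it is split into the contributions of all earlier letters. *)
Fixpoint area_stat (w : seq letter) : int :=
  if w is x :: w' then slope x * (num U w')%:Z + area_stat w' else 0.

Lemma area_stat_pairwise (T : eqType) (lt : rel T) (lab : T -> letter) s :
  uniq s -> pairwise lt s -> {in s, irreflexive lt} ->
  {in s &, forall a b, lt a b -> ~~ lt b a} ->
  area_stat (map lab s) =
  \sum_(a <- s) \sum_(b <- s | lt a b) slope (lab a) * (lab b == U)%:Z.
Proof.
elim: s => [|a s IHs] /=; first by rewrite big_nil.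
case/andP=> a_s uniq_s /andP[/allP lt_as sorted_s] irr asym.
rewrite big_cons big_cons irr ?mem_head // IHs //; first last.
- by move=> x y sx sy; apply: asym; rewrite inE ?sx ?sy orbT.
- by move=> x sx; apply: irr; rewrite inE sx orbT.
congr (_ + _).
  rewrite big_seq_cond (eq_bigl (fun b => b \in s)) => [|b]; last first.
    by case: (boolP (b \in s)) => //= /lt_as.
  rewrite -big_seq -mulr_sumr; congr (_ * _).
  rewrite /num count_map -sum1_count (big_morph _ PoszD (erefl 0%:Z)) big_mkcond /=.
  by apply: eq_bigr => b _; case: (_ == _).
rewrite [LHS]big_seq [RHS]big_seq; apply: eq_bigr => b sb.
rewrite big_cons ifN // asym ?mem_head ?lt_as //.
by rewrite inE sb orbT.
Qed.

Section Output.
Variables (p : wrp_presentation letter letter) (w : seq letter).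
Implicit Types a b c : atom p w.

Lemma lex_lt_trans d : transitive (@lex_lt d).
Proof. by move=> v u x; apply: lt_trans. Qed.

Lemma lex_lt_total d (u v : 'rV[int]_d) : [|| lex_lt u v, u == v | lex_lt v u].
Proof.
rewrite /lex_lt; case: ltgtP => [//|_|eq_uv]; rewrite ?orbT ?orbF //=.
apply/eqP/rowP => i; have /(congr1 (fun t => tnth t i)) := eq_uv.
by rewrite !tnth_mktuple.
Qed.

Lemma lex_lt_irr d (u : 'rV[int]_d) : lex_lt u u = false.
Proof. exact: ltxx. Qed.

Lemma atom_lt_irr : {in @selected _ _ p w, irreflexive (@atom_lt _ _ p w)}.
Proof. by move=> a sa; rewrite /atom_lt lex_lt_irr chi_irr // andbF. Qed.

Lemma atom_lt_trans : {in @selected _ _ p w & &, transitive (@atom_lt _ _ p w)}.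
Proof.
move=> b a c sb sa sc; rewrite /atom_lt.
case/orP=> [lt_ab|/andP[/eqP-> chi_ab]] /orP[lt_bc|/andP[/eqP eq_bc chi_bc]].
- by rewrite (lex_lt_trans lt_ab lt_bc).
- by rewrite -eq_bc lt_ab.
- by rewrite lt_bc.
by rewrite eq_bc eqxx (chi_trans sb sa sc chi_ab chi_bc) orbT.
Qed.

Lemma atom_lt_total :
  {in @selected _ _ p w &, forall a b, a != b -> atom_lt a b || atom_lt b a}.
Proof.
move=> a b sa sb neq_ab; rewrite /atom_lt.
have /or3P[-> //|/eqP eq_ab|-> //] := lex_lt_total (atom_rank a) (atom_rank b).
  by rewrite eq_ab !eqxx /= lex_lt_irr /= chi_total.
by rewrite !orbT.
Qed.

Definition pair_term a b : int :=
  if [&& selected a, selected b & atom_lt a b]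
  then ((has_label a U : nat)%:Z - (has_label a D : nat)%:Z)
       * (has_label b U : nat)%:Z
  else 0.

Lemma has_label_pick a (g : letter) : selected a ->
  has_label a g = ([pick g | has_label a g] == Some g).
Proof.
move=> sa; have [h [lab_h uniq_h]] := label_unique sa.
case: pickP => [h' lab_h'|/(_ h)]; last by rewrite lab_h.
apply/idP/eqP => [/uniq_h eq_g|[<-] //].
by rewrite -(uniq_h _ lab_h') eq_g.
Qed.

Lemma area_stat_output :
  area_stat (wrp_output p w) = \sum_a \sum_b pair_term a b.
Proof.
pose lab a := odflt U [pick g | has_label a g].
have labP a : selected a -> [pick g | has_label a g] = Some (lab a).
  move=> sa; rewrite /lab; case: pickP => // no_lab.
  by have [g []] := label_unique sa; rewrite no_lab.
have mem_s a : (a \in sorted_atoms p w) = selected a.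
  by rewrite mem_sort mem_enum.
have uniq_s : uniq (sorted_atoms p w) by rewrite sort_uniq enum_uniq.
have lt_neq : {in @selected _ _ p w &, forall a b, atom_lt a b -> ~~ atom_lt b a}.
  move=> a b sa sb lt_ab; apply/negP => lt_ba.
  by have := atom_lt_trans sb sa sa lt_ab lt_ba; rewrite atom_lt_irr.
have sorted_s : pairwise (@atom_lt _ _ p w) (sorted_atoms p w).
  have all_s : all (@selected _ _ p w) (enum (@selected _ _ p w)).
    by apply/allP => a; rewrite mem_enum.
  pose le a b := (a == b) || atom_lt a b.
  have le_trans : {in @selected _ _ p w & &, transitive le}.
    move=> b a c sb sa sc /predU1P[-> //|lt_ab] /predU1P[<-|lt_bc].
      by rewrite /le lt_ab orbT.
    by rewrite /le (atom_lt_trans sb sa sc) ?orbT.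
  have le_total : {in @selected _ _ p w &, total le}.
    move=> a b sa sb; rewrite /le; case: eqVneq => //= neq_ab.
    exact: atom_lt_total.
  have := sort_sorted_in le_total all_s.
  rewrite (sorted_pairwise_in le_trans) ?all_sort //.
  have := uniq_s; rewrite uniq_pairwise => neq_s le_s.
  have := pairwise_relI (fun a b => a != b) le (sorted_atoms p w).
  rewrite neq_s le_s; apply: sub_pairwise => a b /andP[neq_ab].
  by rewrite /le (negbTE neq_ab).
have -> : wrp_output p w = map lab (sorted_atoms p w).
  rewrite /wrp_output; have: all (@selected _ _ p w) (sorted_atoms p w).
    by apply/allP => a; rewrite mem_s.
  by elim: (sorted_atoms p w) => //= a s IHs /andP[/labP-> /IHs->].
rewrite (@area_stat_pairwise _ (@atom_lt _ _ p w)) //; first last.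
- by move=> a b; rewrite !mem_s; apply: lt_neq.
- by move=> a; rewrite mem_s; apply: atom_lt_irr.
have big_s (F : atom p w -> int) :
    \sum_(a <- sorted_atoms p w) F a = \sum_(a | selected a) F a.
  rewrite -big_enum; apply: perm_big.
  by apply: uniq_perm; rewrite ?enum_uniq // => a; rewrite mem_s mem_enum.
rewrite big_s [RHS](bigID (@selected _ _ p w)) /= [X in _ = _ + X]big1 ?addr0; last first.
  by move=> a /negbTE sa; rewrite big1 // => b _; rewrite /pair_term sa.
apply: eq_bigr => a sa; rewrite big_mkcond big_s.
rewrite [RHS](bigID (@selected _ _ p w)) /= [X in _ = _ + X]big1 ?addr0; last first.
  by move=> b /negbTE sb; rewrite /pair_term sb andbF.
apply: eq_bigr => b sb; rewrite /pair_term sa sb /=; case: ifP => // _.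
by rewrite !has_label_pick // !labP //; case: (lab a); case: (lab b).
Qed.

End Output.

(** * Each pair of atoms sees boundedly many blocks of the input *)

Definition avoids (i n : nat) (e : seq nat) : bool :=
  all (fun y => (y < i) || (i + n <= y))%N e.

Section RankMachine.
Variables (Sigma : finType) (d : nat) (A : rank_source Sigma d) (j : 'I_d).

Definition rank_machine : machine Sigma :=
  Machine (@rs_step _ _ A) (fun q x => rs_weight q x 0 j).

Lemma prefix_rank_weight w i :
  prefix_rank A w i 0 j = @weight _ rank_machine (rs_init A) (take i w).
Proof.
rewrite /prefix_rank /state_before summxE; move: (rs_init A) => q.
elim: w i q => [|x w IHw] [|i] q; rewrite /= ?big_ord0 //; first by rewrite big1.
rewrite big_mkcond big_ord_recl /= (tnth_nth x) /= -IHw [in RHS]big_mkcond.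
congr (_ + _); apply: eq_bigr => k _.
by rewrite !(tnth_nth x) /=.
Qed.

End RankMachine.

(** Outside of the positions of a pair of atoms an automaton only reads unmarked
    letters, and there it is a machine over the original alphabet. *)
Definition aut_machine (Sigma : Type) (k : nat) (A : automaton (marked Sigma)) :
    machine Sigma :=
  Machine (fun q x => @step _ A q (x, nseq k false, [::])) (fun _ _ => 0).

Lemma accepts_swap (Sigma : Type) k (A : automaton (marked Sigma))
    (u v w1 w2 : seq Sigma) e :
  size e = k -> size u = size v -> indist (aut_machine k A) u v ->
  avoids (size w1) (size u) e ->
  accepts A (mark 0 (w1 ++ u ++ w2) e [::]) =
  accepts A (mark 0 (w1 ++ v ++ w2) e [::]).
Proof.
move=> sz_e sz_uv uv e_out; rewrite /accepts !mark_cat -sz_uv !foldl_cat.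
rewrite (mark_unmarked (w := u)) // (mark_unmarked (w := v)) -?sz_uv // sz_e.
congr (final (foldl _ _ _)).
set q := foldl _ _ (mark 0 w1 _ _); have [+ _] := uv q; rewrite /=.
have run (s : seq Sigma) r :
    foldl (@step _ A) r [seq (x, nseq k false, [::]) | x <- s] =
    foldl (fun q x => step q (x, nseq k false, [::])) r s.
  by elim: s r => /=.
rewrite !run; exact.
Qed.

(** A prefix ending outside of the exchanged factor contains all or nothing of
    it. *)
Lemma take_swap (T : Type) (w1 u v w2 : seq T) i :
  size u = size v -> (i < size w1)%N || (size w1 + size u <= i)%N ->
  (take i (w1 ++ u ++ w2) = take i w1 /\ take i (w1 ++ v ++ w2) = take i w1) \/
  exists n, take i (w1 ++ u ++ w2) = w1 ++ u ++ take n w2 /\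
            take i (w1 ++ v ++ w2) = w1 ++ v ++ take n w2.
Proof.
move=> sz_uv /orP[lt_i|le_i].
  by left; rewrite !takel_cat // ltnW.
right; exists (i - (size w1 + size u))%N; rewrite !take_cat -sz_uv.
have -> : (i < size w1)%N = false by lia.
have -> : (i - size w1 < size u)%N = false by lia.
by rewrite subnDA.
Qed.

Section Local.
Variable p : wrp_presentation letter letter.
Notation d := (wrp_dim p).

(** The data of a pair of atoms as functions of the word and of the positions
    seen as naturals, so that they make sense for all words of a given length
    simultaneously. *)
Definition pos_sel (w : seq letter) (c : copy p) (e : seq nat) : bool :=
  accepts (mso_aut (sel_formula c)) (mark 0 w e [::]).
Definition pos_label (w : seq letter) (c : copy p) (g : letter) (e : seq nat) :
    bool :=
  accepts (mso_aut (label_formula c g)) (mark 0 w e [::]).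
Definition pos_chi (w : seq letter) (c c' : copy p) (e e' : seq nat) : bool :=
  accepts (mso_aut (order_formula c c')) (mark 0 w (e ++ e') [::]).
Definition pos_rank (w : seq letter) (c : copy p) (e : seq nat) : 'rV[int]_d :=
  rf_const (wrp_rank c) +
  \sum_(r < arity c)
    (prefix_rank (rf_source (wrp_rank c) r) w (nth 0%N e r) +
     rf_table (state_before (rf_source (wrp_rank c) r) w (nth 0%N e r))
              (nth U w (nth 0%N e r))).
Definition pos_term (w : seq letter) (c : copy p) (e : seq nat) (c' : copy p)
    (e' : seq nat) : int :=
  if [&& pos_sel w c e, pos_sel w c' e' &
         lex_lt (pos_rank w c e) (pos_rank w c' e')
         || (pos_rank w c e == pos_rank w c' e') && pos_chi w c c' e e']
  then ((pos_label w c U e : nat)%:Z - (pos_label w c D e : nat)%:Z)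
       * (pos_label w c' U e' : nat)%:Z
  else 0.

Lemma models_aut (w : seq letter) k (phi : mso letter k 0)
    (e : k.-tuple 'I_(size w)) :
  models w phi e = accepts (mso_aut phi) (mark 0 w (map val e) [::]).
Proof. by rewrite /models mso_autP. Qed.

Lemma atom_rank_pos w (a : atom p w) :
  atom_rank a = pos_rank w (tag a) (map val (tagged a)).
Proof.
case: a => c e; rewrite /atom_rank /rank_eval /pos_rank /=; congr (_ + _).
apply: eq_bigr => r _.
by rewrite (nth_map (tnth e r)) ?size_tuple // -tnth_nth (tnth_nth U).
Qed.

Lemma pair_term_pos w (a b : atom p w) :
  pair_term a b =
  pos_term w (tag a) (map val (tagged a)) (tag b) (map val (tagged b)).
Proof.
rewrite /pair_term /pos_term /selected /has_label /atom_lt /chi !models_aut.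
by rewrite !atom_rank_pos /= map_cat.
Qed.

Definition machine_index : finType :=
  (copy p + copy p * letter + copy p * copy p +
   {c : copy p & ('I_(arity c) * 'I_d)%type})%type.

Definition presentation_machine (j : machine_index) : machine letter :=
  match j with
  | inl (inl (inl c)) => aut_machine (arity c) (mso_aut (sel_formula c))
  | inl (inl (inr (c, g))) => aut_machine (arity c) (mso_aut (label_formula c g))
  | inl (inr (c, c')) =>
      aut_machine (arity c + arity c') (mso_aut (order_formula c c'))
  | inr (existT c (r, i)) => rank_machine (rf_source (wrp_rank c) r) i
  end.

Section Swap.
Variables u v w1 w2 : seq letter.
Hypothesis sz_uv : size u = size v.
Hypothesis uv : forall j, indist (presentation_machine j) u v.
Variables (c : copy p) (e : seq nat).
Hypothesis sz_e : size e = arity c.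
Hypothesis e_out : avoids (size w1) (size u) e.

Lemma pos_sel_swap : pos_sel (w1 ++ u ++ w2) c e = pos_sel (w1 ++ v ++ w2) c e.
Proof. exact: (accepts_swap w2 sz_e sz_uv (@uv (inl (inl (inl c))))). Qed.

Lemma pos_label_swap g :
  pos_label (w1 ++ u ++ w2) c g e = pos_label (w1 ++ v ++ w2) c g e.
Proof. exact: (accepts_swap w2 sz_e sz_uv (@uv (inl (inl (inr (c, g)))))). Qed.

Lemma pos_rank_swap : pos_rank (w1 ++ u ++ w2) c e = pos_rank (w1 ++ v ++ w2) c e.
Proof.
congr (_ + _); apply: eq_bigr => r _; set y := nth _ _ _.
have y_out : (y < size w1)%N || (size w1 + size u <= y)%N.
  by apply: (allP e_out); rewrite mem_nth ?sz_e.
have machineP i := @uv (inr (existT _ c (r, i))).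
congr (_ + _); last first.
  apply/rowP => i; congr (rf_table _ _ _ _).
    rewrite /state_before.
    have [[-> ->]//|[n [-> ->]]] := take_swap w2 sz_uv y_out.
    by rewrite !foldl_cat; have /= [-> _] := machineP i (foldl (@rs_step _ _ _) (rs_init _) w1).
  rewrite !nth_cat; case: ltnP => // le_y; rewrite -sz_uv.
  by have -> : (y - size w1 < size u)%N = false by lia.
apply/rowP => i; rewrite !prefix_rank_weight.
have [[-> ->]//|[n [-> ->]]] := take_swap w2 sz_uv y_out.
rewrite !weight_cat; congr (_ + _).
by have [-> ->] := machineP i (foldl (@rs_step _ _ _) (rs_init _) w1).
Qed.

End Swap.

Lemma pos_term_swap u v w1 w2 c e c' e' :
  size u = size v -> (forall j, indist (presentation_machine j) u v) ->
  size e = arity c -> size e' = arity c' ->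
  avoids (size w1) (size u) (e ++ e') ->
  pos_term (w1 ++ u ++ w2) c e c' e' = pos_term (w1 ++ v ++ w2) c e c' e'.
Proof.
move=> sz_uv uv sz_e sz_e' out.
have /andP[out_e out_e'] : avoids (size w1) (size u) e && avoids (size w1) (size u) e'.
  by rewrite /avoids -all_cat.
have chi_swap : pos_chi (w1 ++ u ++ w2) c c' e e' = pos_chi (w1 ++ v ++ w2) c c' e e'.
  apply: (accepts_swap w2 _ sz_uv (uv (inl (inr (c, c')))) out).
  by rewrite size_cat sz_e sz_e'.
rewrite /pos_term !(pos_sel_swap w2 sz_uv uv) // !(pos_rank_swap w2 sz_uv uv) //.
by rewrite chi_swap !(pos_label_swap w2 sz_uv uv).
Qed.

(** Each position meets at most one of the m disjoint blocks. *)
Lemma exists_avoided_block n0 L C m (e : seq nat) :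
  (size e < m)%N -> exists2 i, (i < m)%N & avoids (n0 + i * (L + C))%N L e.
Proof.
move=> lt_em; pose blocks := [seq ((y - n0) %/ (L + C))%N | y <- e].
have [i lt_im i_out] : exists2 i, (i < m)%N & i \notin blocks.
  have [/allP sub|/allPn[i]] := boolP (all [in blocks] (iota 0 m)).
    have := uniq_leq_size (iota_uniq 0 m) sub.
    by rewrite size_iota size_map leqNgt lt_em.
  by rewrite mem_iota => lt_im i_out; exists i.
exists i => //; apply/allP => y e_y; apply: contraR i_out.
rewrite negb_or -leqNgt -ltnNge => /andP[le_y lt_y].
apply/mapP; exists y => //; apply/eqP; rewrite eqn_leq.
by rewrite leq_divRL -1?ltnS ?ltn_divLR; nia.
Qed.

Lemma area_stat_output_pos (w : seq letter) (N : nat) : size w = N ->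
  area_stat (wrp_output p w) =
  \sum_(ab : {c : copy p & (arity c).-tuple 'I_N}
            * {c : copy p & (arity c).-tuple 'I_N})
    pos_term w (tag ab.1) (map val (tagged ab.1))
               (tag ab.2) (map val (tagged ab.2)).
Proof.
move=> {N}<-; rewrite area_stat_output pair_big /=.
by apply: eq_bigr => -[a b] _; rewrite pair_term_pos.
Qed.

(** No pair of atoms has positions in all m blocks, so that every term of the
    double sum ignores some bit. *)
Theorem alt_area_stat_output m w1 w2 C (blk : bool -> seq letter) :
  (forall c c' : copy p, arity c + arity c' < m)%N ->
  size (blk true) = size (blk false) ->
  (forall j, indist (presentation_machine j) (blk true) (blk false)) ->
  alt_sum m (fun x => area_stat (wrp_output p
    (w1 ++ flatten [seq blk b ++ C | b <- x] ++ w2))) = 0.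
Proof.
move=> lt_m sz_blk ind_blk; set L := size (blk true).
pose word x := w1 ++ flatten [seq blk b ++ C | b <- x] ++ w2.
have sz_flat x : size (flatten [seq blk b ++ C | b <- x]) = (size x * (L + size C))%N.
  elim: x => //= b x IHx; rewrite !size_cat IHx mulSn.
  by rewrite /L; case: b; rewrite ?sz_blk.
pose N := (size w1 + (m * (L + size C) + size w2))%N.
have sz_word x : size x = m -> size (word x) = N.
  by move=> sz_x; rewrite !size_cat sz_flat sz_x.
pose A := {c : copy p & (arity c).-tuple 'I_N}.
pose term (ab : A * A) x :=
  pos_term (word x) (tag ab.1) (map val (tagged ab.1))
                    (tag ab.2) (map val (tagged ab.2)).
transitivity (alt_sum m (fun x => \sum_ab term ab x)).
  by apply: eq_alt_sum => x /sz_word sz_x; apply: area_stat_output_pos.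
rewrite alt_sum_sum big1 // => -[[c e] [c' e']] _; rewrite /term /=.
have [|i lt_im avoid_i] :=
    @exists_avoided_block (size w1) L (size C) m (map val e ++ map val e').
  by rewrite size_cat !size_map !size_tuple.
apply: (alt_sum_indep lt_im) => x y sz_x _; rewrite /word.
rewrite !map_cat !flatten_cat /= -!catA !(catA w1).
apply: pos_term_swap => //; try by rewrite size_map size_tuple.
by rewrite size_cat sz_flat sz_x.
Qed.

End Local.

(** * Dyck paths read from left to right *)

Fixpoint dyck_from (h : nat) (w : seq letter) : bool :=
  match w with
  | [::] => h == 0%N
  | U :: w' => dyck_from h.+1 w'
  | D :: w' => (0 < h)%N && dyck_from h.-1 w'
  end.

Fixpoint areas (h : nat) (w : seq letter) : seq nat :=
  match w with
  | [::] => [::]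
  | U :: w' => h :: areas h.+1 w'
  | D :: w' => areas h.-1 w'
  end.

(** The number of letters U before the letter D number j, counted from 0. *)
Fixpoint ups (w : seq letter) (j : nat) : nat :=
  match w with
  | [::] => 0
  | U :: w' => (ups w' j).+1
  | D :: w' => if j is j'.+1 then ups w' j' else 0
  end.

Local Arguments height : simpl never.

Lemma num_nil x : num x [::] = 0%N. Proof. by []. Qed.
Lemma num_cons x y w : num x (y :: w) = ((y == x) + num x w)%N.
Proof. by []. Qed.
Lemma num_cat x w1 w2 : num x (w1 ++ w2) = (num x w1 + num x w2)%N.
Proof. exact: count_cat. Qed.
Lemma num_nseq x y n : num x (nseq n y) = ((y == x) * n)%N.
Proof. exact: count_nseq. Qed.

Lemma height0 w : height w 0 = 0.
Proof. by rewrite /height take0. Qed.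

Lemma height_cons x w k : height (x :: w) k.+1 = slope x + height w k.
Proof. by rewrite /height -!/(num _ _) /= !num_cons; case: x => /=; lia. Qed.

Lemma dyck_fromP h w :
  reflect (h%:Z + height w (size w) = 0 /\
           forall k, (k <= size w)%N -> 0 <= h%:Z + height w k)
          (dyck_from h w).
Proof.
apply: (iffP idP); elim: w h => [|x w IHw] h.
- by move=> /eqP->; split=> [|[|k] //]; rewrite height0.
- have step h' : h%:Z + slope x = h'%:Z -> dyck_from h' w ->
      h%:Z + height (x :: w) (size (x :: w)) = 0 /\
      (forall k, (k <= size (x :: w))%N -> 0 <= h%:Z + height (x :: w) k).
    move=> def_h' /IHw[eq0 ge0]; rewrite /= height_cons addrA def_h'; split=> //.
    case=> [|k] le_k; first by rewrite height0 addr0.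
    by rewrite height_cons addrA def_h' ge0.
  case: x step => step /=; first by apply: step; rewrite /=; lia.
  by case/andP=> h_gt0; apply: step; rewrite /=; lia.
- by rewrite /= height0 => -[/eqP]; rewrite addr0.
have step h' : h%:Z + slope x = h'%:Z ->
    h%:Z + height (x :: w) (size (x :: w)) = 0 ->
    (forall k, (k <= size (x :: w))%N -> 0 <= h%:Z + height (x :: w) k) ->
    dyck_from h' w.
  move=> def_h'; rewrite /= height_cons addrA def_h' => eq0 ge0; apply: IHw.
  by split=> // k le_k; have := ge0 k.+1 le_k; rewrite height_cons addrA def_h'.
case: x step => step [eq0 ge0] /=; first by apply: step eq0 ge0; rewrite /=; lia.
have h_gt0 : (0 < h)%N.
  by have := ge0 1%N isT; rewrite height_cons height0 /=; lia.
by rewrite h_gt0; apply: step eq0 ge0; rewrite /=; lia.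
Qed.

Lemma dyckE w : dyck w = dyck_from 0 w.
Proof.
apply/andP/dyck_fromP => [[/eqP eq0 /forallP ge0]|[eq0 ge0]].
  split=> [|k le_k]; first by rewrite add0r.
  by rewrite add0r; apply: (ge0 (Ordinal (n := (size w).+1) le_k)).
split; first by rewrite add0r in eq0; apply/eqP.
by apply/forallP => k; have := ge0 k (ltn_ord k); rewrite add0r.
Qed.

Lemma dyck_from_count h w : dyck_from h w -> (h + num U w = num D w)%N.
Proof.
elim: w h => [|x w IHw] h; first by move/eqP->.
rewrite !num_cons; case: x => /= [/IHw|/andP[h_gt0 /IHw]]; lia.
Qed.

Lemma area_seqE w : dyck w -> area_seq w = areas 0 w.
Proof.
suff areasE h : (forall k, (k <= size w)%N -> 0 <= h%:Z + height w k) ->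
    [seq absz (h%:Z + height w k) | k <- iota 0 (size w) & nth D w k == U]
    = areas h w.
  rewrite dyckE => /dyck_fromP[_ /areasE <-].
  by apply: eq_map => k; rewrite add0r.
elim: w h => //= x w IHw h ge0.
have step h' : h%:Z + slope x = h'%:Z ->
    [seq absz (h%:Z + height (x :: w) k) | k <- iota 1 (size w) & nth D (x :: w) k == U]
    = areas h' w.
  move=> def_h'; rewrite -IHw => [|k le_k]; last first.
    by have := ge0 k.+1 le_k; rewrite height_cons addrA def_h'.
  rewrite -[1%N]addn0 iotaDl filter_map -map_comp.
  rewrite (eq_filter (a2 := fun k => nth D w k == U)) //.
  by apply: eq_map => k; rewrite /= add1n height_cons addrA def_h'.
case: x step {IHw} ge0 => step ge0 /=; last first.
  have h_gt0 : (0 < h)%N.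
    by have := ge0 1%N isT; rewrite height_cons height0 /=; lia.
  by apply: step; rewrite /=; lia.
rewrite !addn0 (step h.+1) //=; lia.
Qed.

Lemma sumn_areas h w : dyck_from h w ->
  (sumn (areas h w))%:Z = (h * num U w)%N%:Z + area_stat w.
Proof.
elim: w h => [|x w IHw] h; first by rewrite muln0.
rewrite num_cons; case: x => /= [/IHw|/andP[h_gt0 /IHw->]]; last by nia.
by rewrite PoszD => ->; lia.
Qed.

Lemma size_areas h w : size (areas h w) = num U w.
Proof. by elim: w h => [|[] w IHw] h //=; rewrite IHw num_cons. Qed.

Lemma ups_mono w : {homo ups w : i j / (i <= j)%N}.
Proof. by elim: w => [|[] w IHw] // [|i] [|j] //= le_ij; apply: IHw. Qed.

Lemma ups_ge w j : (num D w <= j)%N -> ups w j = num U w.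
Proof.
elim: w j => [|x w IHw] j //; rewrite !num_cons.
case: x => [|le_j]; [move=> le_j | case: j le_j => [|j] // le_j].
  by rewrite /= IHw.
by rewrite /= IHw.
Qed.

Lemma dyck_from_ups h w j : dyck_from h w -> (j < num D w)%N ->
  (j < h + ups w j)%N.
Proof.
elim: w h j => [|[] w IHw] h j //; rewrite num_cons /=.
  by move/IHw => /(_ j); rewrite addnS.
case/andP=> h_gt0 /IHw lt_ups; case: j => [|j]; first by rewrite addn0.
by rewrite add1n ltnS => /lt_ups; lia.
Qed.

(** A word is a queue discipline: each letter D, together with the letters U
    that follow it, records how many nodes the next node of a breadth-first
    traversal adds to the queue. *)
Definition bfs_word (f : nat -> nat) (s e : nat) : seq letter :=
  flatten [seq D :: nseq (f j.+1 - f j) U | j <- index_iota s e].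

Lemma ups_bfs_word w :
  w = nseq (ups w 0) U ++ bfs_word (ups w) 0 (num D w).
Proof.
rewrite /bfs_word /index_iota subn0; elim: w => [|x w IHw] //.
case: x; rewrite num_cons /= add0n.
  rewrite [in LHS]IHw; congr (_ :: _ ++ flatten _).
rewrite subn0 [in LHS]IHw; congr (_ :: _ ++ flatten _).
by rewrite -[in RHS](addn0 1%N) iotaDl -map_comp; apply: eq_map.
Qed.

(** * Inverting the zeta map: from breadth-first to depth-first order *)

Lemma zeta_level_cat a b r :
  zeta_level (a ++ b) r = zeta_level a r ++ zeta_level b r.
Proof. exact: pmap_cat. Qed.

Lemma zeta_level_flatten (s : seq (seq nat)) r :
  zeta_level (flatten s) r = flatten [seq zeta_level a r | a <- s].
Proof. by elim: s => //= a s IHs; rewrite zeta_level_cat IHs. Qed.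

Lemma zeta_level_nil a r : all (fun x => x != r) a ->
  all (fun x => x.+1 != r) a -> zeta_level a r = [::].
Proof.
rewrite /zeta_level; elim: a => //= x a IHa /andP[/negbTE-> /IHa IH].
by case/andP=> /negbTE-> /IH.
Qed.

(** Levels above the maximum are empty, so the number of levels to be scanned
    need not be computed exactly. *)
Lemma flatten_zeta_levels a R R' :
  all (fun x => x.+1 < R)%N a -> all (fun x => x.+1 < R')%N a ->
  flatten [seq zeta_level a r | r <- iota 0 R] =
  flatten [seq zeta_level a r | r <- iota 0 R'].
Proof.
wlog le_RR' : R R' / (R <= R')%N.
  by move=> IH aR aR'; case/orP: (leq_total R R') => /IH->.
move=> aR _; rewrite -(subnKC le_RR') iotaD map_cat flatten_cat.
rewrite [X in _ ++ X](_ : _ = [::]) ?cats0 // add0n.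
have: all (leq R) (iota R (R' - R)).
  by apply/allP => r; rewrite mem_iota => /andP[].
elim: (iota _ _) => //= r s IHs /andP[le_r /IHs->]; rewrite cats0.
by apply: zeta_level_nil; apply: sub_all aR => x; lia.
Qed.

(** The nodes of a forest are numbered in breadth-first order, and f j is the
    number of nodes met when node j is about to be expanded: its children are
    numbered from f j to f j.+1 - 1. The first argument of the fixpoints is
    fuel, an upper bound on the depth of the forest. *)
Section Forest.
Variable f : nat -> nat.

Fixpoint tree (k j : nat) : seq letter :=
  if k is k'.+1
  then U :: flatten [seq tree k' i | i <- index_iota (f j) (f j.+1)] ++ [:: D]
  else [::].
Definition forest k s e := flatten [seq tree k i | i <- index_iota s e].

Fixpoint tree_depths (k h j : nat) : seq nat :=
  if k is k'.+1
  then h :: flatten [seq tree_depths k' h.+1 i | i <- index_iota (f j) (f j.+1)]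
  else [::].
Definition depths k h s e := flatten [seq tree_depths k h i | i <- index_iota s e].

Lemma areas_forest_cat k h s e w :
  areas h (forest k s e ++ w) = depths k h s e ++ areas h w.
Proof.
rewrite /forest /depths; elim: k h w (index_iota s e) => [|k IHk] h w l.
  by elim: l.
elim: l => //= j l IHl; rewrite -!catA /= IHk /=; congr (_ :: _ ++ _).
exact: IHl.
Qed.

Lemma dyck_from_forest_cat k h s e w :
  dyck_from h (forest k s e ++ w) = dyck_from h w.
Proof.
rewrite /forest; elim: k h w (index_iota s e) => [|k IHk] h w l.
  by elim: l.
by elim: l => //= j l IHl; rewrite -!catA /= IHk.
Qed.

Hypothesis f_mono : {homo f : i j / (i <= j)%N}.

Lemma index_iota_cat s e t : (s <= e <= t)%N ->
  index_iota s t = index_iota s e ++ index_iota e t.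
Proof.
case/andP=> le_se le_et; rewrite /index_iota.
have -> : (t - s = (e - s) + (t - e))%N by lia.
by rewrite iotaD subnKC.
Qed.

(** The nodes of one depth have consecutive numbers: an interval of parents has
    an interval of children. *)
Lemma flatten_children (T : Type) (F : nat -> seq T) s e : (s <= e)%N ->
  flatten [seq flatten [seq F i | i <- index_iota (f j) (f j.+1)]
             | j <- index_iota s e]
  = flatten [seq F i | i <- index_iota (f s) (f e)].
Proof.
elim: e => [|e IHe]; first by rewrite leqn0 => /eqP->; rewrite /index_iota !subnn.
rewrite leq_eqVlt => /predU1P[->|]; first by rewrite /index_iota !subnn.
rewrite ltnS => le_se; rewrite (@index_iota_cat s e) ?le_se ?leqnSn //.
rewrite (@index_iota_cat (f s) (f e)) ?f_mono // !map_cat !flatten_cat IHe //.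
by rewrite [index_iota e _]/index_iota subSnn /= cats0.
Qed.

Lemma depths_ge k h s e : all (leq h) (depths k h s e).
Proof.
rewrite /depths; elim: k h (index_iota s e) => [|k IHk] h l; first by elim: l.
elim: l => //= j l IHl; rewrite all_cat leqnn IHl andbT.
by apply: sub_all (IHk h.+1 _) => x; apply: ltnW.
Qed.

Lemma zeta_level_depthsS k h s e r :
  zeta_level (depths k.+1 h s e) r =
  flatten [seq (if h == r then [:: U] else if h.+1 == r then [:: D] else [::]) ++
                zeta_level (depths k h.+1 (f j) (f j.+1)) r
             | j <- index_iota s e].
Proof.
rewrite zeta_level_flatten -map_comp; congr flatten; apply: eq_map => j.
by rewrite /zeta_level /=; case: eqP => //; case: eqP.
Qed.

(** Nodes of depth r - 1 and r alternate in the scan of level r as each parent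
    followed by its children, whence the breadth-first word. *)
Lemma zeta_level_depths k h s e r : (s <= e)%N -> (r < k)%N ->
  zeta_level (depths k h s e) (h + r) =
  if r is r'.+1 then bfs_word f (iter r' f s) (iter r' f e) else nseq (e - s) U.
Proof.
elim: k h s e r => // k IHk h s e r le_se lt_rk.
rewrite zeta_level_depthsS; case: r lt_rk => [_|[|r] lt_rk].
- rewrite addn0 -[in RHS](size_iota s (e - s)) /index_iota eqxx.
  elim: (iota _ _) => //= j l ->; rewrite zeta_level_nil //.
    by apply: sub_all (depths_ge k h.+1 _ _) => x; lia.
  by apply: sub_all (depths_ge k h.+1 _ _) => x; lia.
- congr flatten; apply: eq_map => j; rewrite addn1 eqxx ifN; last by lia.
  by have := IHk h.+1 (f j) (f j.+1) 0%N; rewrite addn0 => ->; rewrite ?f_mono.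
rewrite -addSnnS; transitivity (zeta_level (depths k h.+1 (f s) (f e)) (h.+1 + r.+1)).
  rewrite {2}/depths -flatten_children // zeta_level_flatten -map_comp.
  by congr flatten; apply: eq_map => j; rewrite !ifN //; lia.
by rewrite IHk ?f_mono // -!iterSr.
Qed.

Lemma sumn_depths k h s e : (s <= e)%N ->
  sumn (depths k h s e) = (\sum_(r < k) (h + r) * (iter r f e - iter r f s))%N.
Proof.
elim: k h s e => [|k IHk] h s e le_se.
  by rewrite big_ord0 /depths; elim: (index_iota _ _).
have -> : sumn (depths k.+1 h s e) =
          (h * (e - s) + sumn (depths k h.+1 (f s) (f e)))%N.
  rewrite /depths -(flatten_children _ le_se) -(size_iota s (e - s)) -/(index_iota s e).
  elim: (index_iota s e) => [|j l /= IHl] /=; first by rewrite muln0.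
  by rewrite !sumn_cat IHl mulnS; lia.
rewrite IHk ?f_mono // big_ord_recl addn0; congr (_ + _)%N.
by apply: eq_bigr => r _; rewrite -!iterSr addSnnS.
Qed.

Lemma iter_mono r : {homo iter r f : i j / (i <= j)%N}.
Proof. by elim: r => //= r IHr i j /IHr/f_mono. Qed.

Lemma size_depths k h s : (s <= f s)%N ->
  size (depths k h s (f s)) = (iter k f s - s)%N.
Proof.
elim: k h s => [|k IHk] h s le_s.
  by rewrite subnn /depths; elim: (index_iota _ _).
have -> : size (depths k.+1 h s (f s)) =
          (f s - s + size (depths k h.+1 (f s) (f (f s))))%N.
  rewrite /depths -(flatten_children _ le_s) -(size_iota s (f s - s)) -/(index_iota s (f s)).
  elim: (index_iota s (f s)) => [|j l /= IHl] //=.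
  by rewrite !size_cat IHl; lia.
rewrite IHk ?f_mono // iterSr.
suff: (f s <= iter k f (f s))%N by lia.
elim: k {IHk h} => //= k IHk; apply: leq_trans IHk _.
by rewrite -iterS iterSr iter_mono // f_mono.
Qed.

Variable n : nat.
Hypothesis f_gt : forall j, (j < n)%N -> (j < f j)%N.
Hypothesis f_n : f n = n.

Lemma f_le j : (j <= n)%N -> (f j <= n)%N.
Proof. by rewrite -{2}f_n; apply: f_mono. Qed.

(** A child has a larger number than its parent, which bounds the depth. *)
Lemma depths_lt k h s e : (s <= e <= n)%N ->
  all (fun x => x < h + (n - s))%N (depths k h s e).
Proof.
elim: k h s e => [|k IHk] h s e /andP[le_se le_en].
  by rewrite /depths; elim: (index_iota _ _).
apply/allP => x /flattenP[_ /mapP[j + ->]].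
rewrite mem_index_iota => /andP[le_sj lt_je].
have lt_jn : (j < n)%N by apply: leq_trans lt_je le_en.
rewrite inE => /predU1P[->|x_j]; first by lia.
have le_fn : (f j <= f j.+1 <= n)%N by rewrite f_mono ?leqnSn ?f_le.
by have := allP (IHk h.+1 _ _ le_fn) _ x_j; have := f_gt lt_jn; lia.
Qed.

Lemma iter_f_n r : (n <= r)%N -> iter r f 0 = n.
Proof.
move=> le_nr; rewrite -(subnK le_nr) iterD.
have -> : iter n f 0 = n.
  suff go k : (k <= n)%N -> (k <= iter k f 0 <= n)%N.
    by have := go n (leqnn n) => /andP[le1 le2]; apply/eqP; rewrite eqn_leq le1 le2.
  elim: k => // k IHk lt_kn; have /andP[le_k le_n] := IHk (ltnW lt_kn).
  rewrite /= f_le // andbT; move: le_n; rewrite leq_eqVlt => /predU1P[->|lt_n].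
    by rewrite f_n.
  by apply: leq_ltn_trans le_k (f_gt lt_n).
by elim: (r - n)%N => //= k ->.
Qed.

End Forest.

Lemma size_num w : size w = (num U w + num D w)%N.
Proof. by elim: w => //= x w ->; rewrite !num_cons; case: x => /=; lia. Qed.

Section ZetaInverse.

(** The fuel is sufficient as a node of depth r has number at least r. *)
Definition zeta_preimage (P : seq letter) : seq letter :=
  forest (ups P) (num D P).+1 0 (ups P 0).

Variable P : seq letter.
Hypothesis dyck_P : dyck P.
Let f := ups P.
Let n := num D P.

Lemma num_dyck : num U P = n.
Proof. by move: dyck_P; rewrite dyckE => /dyck_from_count. Qed.

Let f_mono : {homo f : i j / (i <= j)%N}. Proof. exact: ups_mono. Qed.
Let f_gt j : (j < n)%N -> (j < f j)%N.
Proof. by move: dyck_P; rewrite dyckE => /dyck_from_ups; apply. Qed.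
Let f_n : f n = n. Proof. by rewrite /f ups_ge // num_dyck. Qed.

Lemma dyck_zeta_preimage : dyck (zeta_preimage P).
Proof. by rewrite dyckE -[zeta_preimage P]cats0 dyck_from_forest_cat. Qed.

Lemma area_seq_zeta_preimage :
  area_seq (zeta_preimage P) = depths f n.+1 0 0 (f 0).
Proof.
rewrite area_seqE ?dyck_zeta_preimage // -[zeta_preimage P]cats0.
by rewrite areas_forest_cat cats0.
Qed.

Lemma num_zeta_preimage : num U (zeta_preimage P) = n.
Proof.
rewrite -(size_areas 0) -area_seqE ?dyck_zeta_preimage // area_seq_zeta_preimage.
by rewrite size_depths // subn0 (iter_f_n f_mono f_gt f_n).
Qed.

Lemma size_zeta_preimage : size (zeta_preimage P) = size P.
Proof.
have := dyck_zeta_preimage; rewrite dyckE => /dyck_from_count; rewrite add0n.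
by rewrite !size_num => <-; rewrite num_zeta_preimage num_dyck.
Qed.

(** The levels of the forest cut its breadth-first word into consecutive
    pieces. *)
Lemma bfs_word_orbit m :
  flatten [seq bfs_word f (iter r f 0) (iter r f (f 0)) | r <- iota 0 m] =
  bfs_word f 0 (iter m f 0).
Proof.
elim: m => [|m IHm]; first by rewrite /bfs_word /index_iota.
rewrite -[in iota _ _]addn1 iotaD map_cat flatten_cat IHm /= cats0 add0n -iterSr /bfs_word.
rewrite -flatten_cat -map_cat -index_iota_cat //=.
case: m {IHm} => //= m; rewrite -[f (iter m f 0)]/(iter m.+1 f 0) iterSr.
by rewrite -iterS iterSr iter_mono // f_mono.
Qed.

Lemma zeta_zeta_preimage : zeta (zeta_preimage P) = P.
Proof.
rewrite /zeta area_seq_zeta_preimage; set a := depths _ _ _ _ _.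
have f0_le : (0 <= f 0 <= n)%N by rewrite f_le.
rewrite (@flatten_zeta_levels a _ n.+1); first last.
- by apply: sub_all (depths_lt f_mono f_gt f_n n.+1 0 f0_le) => x; lia.
- by apply/allP => x a_x; rewrite !ltnS (leq_bigmax_seq _ (P := xpredT)).
have level r : (r < n.+1)%N -> zeta_level a r =
    if r is r'.+1 then bfs_word f (iter r' f 0) (iter r' f (f 0))
    else nseq (f 0 - 0) U.
  exact: zeta_level_depths.
rewrite [RHS]ups_bfs_word -/f -/n /= level // subn0; congr (_ ++ _).
rewrite -[in RHS](iter_f_n f_mono f_gt f_n (leqnn n)).
rewrite -bfs_word_orbit -[1%N]addn0 iotaDl -map_comp; congr flatten.
by apply/eq_in_map => r; rewrite mem_iota /= => lt_rn; rewrite level.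
Qed.

(** The nodes of depth r are numbered from f^r(0) to f^(r+1)(0) - 1; the sum of
    their depths is summed by parts. *)
Lemma area_stat_zeta_preimage :
  area_stat (zeta_preimage P) + (\sum_(r < n.+1) iter r.+1 f 0)%N%:Z =
  (n.+1 * n)%N%:Z.
Proof.
have dQ := dyck_zeta_preimage; have dQ0 := dQ; rewrite dyckE in dQ0.
have := sumn_areas dQ0; rewrite mul0n add0r => <-.
rewrite -area_seqE // area_seq_zeta_preimage sumn_depths // -PoszD; congr Posz.
suff abel m : (\sum_(r < m) (0 + r) * (iter r f (f 0) - iter r f 0) +
               \sum_(r < m) iter r.+1 f 0 = m * iter m f 0)%N.
  by rewrite abel (iter_f_n f_mono f_gt f_n).
elim: m => [|m IHm]; first by rewrite !big_ord0.
have le_m : (iter m f 0 <= iter m.+1 f 0)%N by rewrite iterSr iter_mono.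
have mul_diff : (m * (iter m.+1 f 0 - iter m f 0) + m * iter m f 0 =
                 m * iter m.+1 f 0)%N by rewrite -mulnDr subnK.
rewrite !big_ord_recr -[iter m f (f 0)]iterSr addnACA; rewrite /= in IHm mul_diff *.
by rewrite IHm add0n; lia.
Qed.

End ZetaInverse.

(** The preimage map is injective because zeta is a left inverse of it; on the
    finite set of Dyck paths of a given length it is then surjective, so that
    zeta has no other preimages. *)
Lemma zeta_invE P : dyck P -> zeta_inv P = zeta_preimage P.
Proof.
move=> dyck_P; pose Dy := [set t : (size P).-tuple letter | dyck t].
pose sigma (t : (size P).-tuple letter) := insubd t (zeta_preimage t).
have sigmaE t : t \in Dy -> sigma t = zeta_preimage t :> seq letter.
  by rewrite inE => dt; rewrite val_insubd size_zeta_preimage // size_tuple eqxx.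
have sigma_inj : {in Dy &, injective sigma}.
  move=> t t' Dt Dt' eq_tt'; apply: val_inj => /=.
  move: (Dt) (Dt'); rewrite !inE => dt dt'.
  by rewrite -(zeta_zeta_preimage dt) -(zeta_zeta_preimage dt') -!sigmaE // eq_tt'.
have sigma_Dy : sigma @: Dy = Dy.
  apply/eqP; rewrite eqEcard card_in_imset // leqnn andbT.
  apply/subsetP => _ /imsetP[t Dt ->]; rewrite inE sigmaE //.
  by apply: dyck_zeta_preimage; move: Dt; rewrite inE.
rewrite /zeta_inv; case: pickP => [Q /andP[dQ /eqP zQ]|/(_ (sigma (in_tuple P)))].
  have: Q \in sigma @: Dy by rewrite sigma_Dy inE.
  case/imsetP=> t Dt def_Q; have dt : dyck t by move: Dt; rewrite inE.
  have def_P : P = t by rewrite -(zeta_zeta_preimage dt) -sigmaE // -def_Q zQ.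
  by rewrite [in RHS]def_P -sigmaE // -def_Q.
by rewrite sigmaE ?inE // dyck_zeta_preimage // zeta_zeta_preimage // eqxx.
Qed.

(** * A family of Dyck paths whose bounces compute a conjunction *)

Lemma ups_cat p s j : ups (p ++ s) j =
  if (j < num D p)%N then ups p j else (num U p + ups s (j - num D p))%N.
Proof.
elim: p j => [|x p IHp] j /=; first by rewrite subn0.
rewrite !num_cons; case: x => /=; rewrite ?IHp; first by case: ifP.
by case: j => [|j] //=; rewrite IHp ltnS subSS.
Qed.

Lemma dyck_from_nseqU h n w : dyck_from h (nseq n U ++ w) = dyck_from (h + n) w.
Proof. by elim: n h => [|n IHn] h /=; rewrite ?addn0 // IHn addSnnS. Qed.

Lemma dyck_from_nseqD h n w :
  dyck_from h (nseq n D ++ w) = (n <= h)%N && dyck_from (h - n) w.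
Proof.
elim: n h => [|n IHn] h /=; first by rewrite subn0.
by case: h => //= h; rewrite IHn subSS.
Qed.

Definition bit_code (b : bool) : seq letter := if b then [:: U; D] else [:: D; U].
Definition bits_code (g : seq bool) : seq letter := flatten (map bit_code g).

Lemma num_bits_code x g : num x (bits_code g) = size g.
Proof. by elim: g => //= b g IHg; rewrite num_cat IHg; case: b; case: x {IHg}. Qed.

Lemma ups_bits_code g t : (t < size g)%N ->
  ups (bits_code g) t = (t + nth false g t)%N.
Proof.
by elim: g t => // -[] g IHg [|t] //= lt_t; rewrite IHg.
Qed.

Lemma dyck_from_bits_code h g w : (0 < h)%N ->
  dyck_from h (bits_code g ++ w) = dyck_from h w.
Proof.
by move=> h_gt0; elim: g => //= b g <-; case: b => //=; rewrite h_gt0 prednK.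
Qed.

Lemma ltn_sum_at n i (F G : nat -> nat) : (i < n)%N ->
  (forall r, F r <= G r)%N -> (F i < G i)%N ->
  (\sum_(r < n) F r < \sum_(r < n) G r)%N.
Proof.
move=> lt_in leFG ltFG; rewrite (bigD1 (Ordinal lt_in)) //=.
rewrite [X in (_ < X)%N](bigD1 (Ordinal lt_in)) //= -addSn leq_add //.
exact: leq_sum.
Qed.

Section Family.
Variables (L t : nat) (blk : bool -> seq bool).
Hypothesis lt_tL : (t < L)%N.
Hypothesis size_blk : forall b, size (blk b) = L.
Hypothesis blk_t : forall b, nth false (blk b) t = b.

(** One period of a path of the family consists of a block of L factors UD or
    DU, chosen by one bit, and of a gap; the number t is that of a factor at
    which the two contents of the block differ. The start and each gap leave the
    height at 2L, so that the letters D of the block are sent by f to the region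
    of the first run of D in the gap. This run ends with the image of factor t
    for the bit false, and L letters U separate it from the next letter D, the
    image of factor t for the bit true. The lengths of the last two runs put the larger
    value of f on factor t of the next block, and the smaller one on a letter
    before that block that f sends beyond it. *)
Definition start_word : seq letter :=
  nseq t.+1 U ++ [:: D] ++ nseq (2 * L - t) U.
Definition gap_word : seq letter :=
  [:: U] ++ nseq (L + t + 1) D ++ nseq L U ++ [:: D] ++ nseq (2 * L - t) U
  ++ nseq (2 * L - 2 * t - 1) D.
Definition blocks_word (x : seq bool) : seq letter :=
  flatten [seq bits_code (blk b) ++ gap_word | b <- x].
Definition family_word (x : seq bool) : seq letter :=
  start_word ++ blocks_word x ++ nseq (2 * L) D.

Definition period : nat := (4 * L - t + 1)%N.
(** The number of letters D before block i. *)
Definition base (i : nat) : nat := (i * period).+1.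

Lemma num_gap x : num x gap_word = (3 * L - t + 1)%N.
Proof. by rewrite !num_cat !num_nseq !num_cons num_nil; case: x => /=; lia. Qed.

Lemma num_blocks x y : num y (blocks_word x) = (size x * period)%N.
Proof.
elim: x => //= b x IHx; rewrite num_cat IHx num_cat num_gap num_bits_code size_blk.
by rewrite /period mulSn; lia.
Qed.

Lemma num_start y : num y start_word = if y is U then (2 * L + 1)%N else 1%N.
Proof. by rewrite !num_cat !num_nseq !num_cons num_nil; case: y => /=; lia. Qed.

Lemma dyck_family x : dyck (family_word x).
Proof.
rewrite dyckE /family_word /start_word -!catA dyck_from_nseqU /=.
rewrite dyck_from_nseqU (_ : (t + (2 * L - t) = 2 * L)%N); last by lia.
have L_gt0 : (0 < 2 * L)%N by lia.
elim: x => [|b x IHx] /=.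
  by rewrite -[nseq _ _]cats0 dyck_from_nseqD leqnn subnn.
rewrite /blocks_word /= -!catA dyck_from_bits_code //=.
rewrite dyck_from_nseqD dyck_from_nseqU /= dyck_from_nseqU dyck_from_nseqD.
set h := (_ + _ - _)%N; have -> : h = (2 * L)%N by rewrite /h; lia.
by rewrite IHx andbT; lia.
Qed.

Lemma ups_family x1 b x2 s :
  ups (family_word (x1 ++ b :: x2)) (base (size x1) + s) =
  (base (size x1) + 2 * L + ups (bits_code (blk b) ++ gap_word ++
     blocks_word x2 ++ nseq (2 * L) D) s)%N.
Proof.
have num_pre y : num y (start_word ++ blocks_word x1) =
    (size x1 * period + if y is U then 2 * L + 1 else 1)%N.
  by rewrite num_cat num_start num_blocks addnC.
have -> : family_word (x1 ++ b :: x2) = (start_word ++ blocks_word x1) ++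
    bits_code (blk b) ++ gap_word ++ blocks_word x2 ++ nseq (2 * L) D.
  by rewrite /family_word /blocks_word map_cat flatten_cat /= -!catA.
rewrite (ups_cat (start_word ++ _)) !num_pre ifN; last first.
  by rewrite /base; lia.
by congr (_ + ups _ _)%N; rewrite /base; lia.
Qed.

Lemma ups_family_block x1 b x2 s : (s < L)%N ->
  ups (family_word (x1 ++ b :: x2)) (base (size x1) + s) =
  (base (size x1) + 2 * L + s + nth false (blk b) s)%N.
Proof.
move=> lt_sL; rewrite ups_family ups_cat num_bits_code size_blk lt_sL.
by rewrite ups_bits_code ?size_blk // addnA.
Qed.

Lemma ups_family_gap x1 b x2 s : (s < 3 * L - t + 1)%N ->
  ups (family_word (x1 ++ b :: x2)) (base (size x1) + L + s) =
  (base (size x1) + 3 * L +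
    if (s <= L + t)%N then 1 else if s == (L + t).+1 then L + 1 else 3 * L - t + 1)%N.
Proof.
move=> lt_s; rewrite -[(base _ + L + s)%N]addnA ups_family ups_cat !num_bits_code.
rewrite size_blk ifN; last by lia.
rewrite addKn (ups_cat gap_word) num_gap lt_s.
suff -> : ups gap_word s =
    (if (s <= L + t)%N then 1 else if s == (L + t).+1 then L + 1 else 3 * L - t + 1)%N.
  by lia.
rewrite /gap_word /=.
rewrite (ups_cat (nseq _ _)) !num_nseq /=.
have ups_U0 n j : ups (nseq n U) j = n by elim: n => //= n ->.
have ups_D0 n j : ups (nseq n D) j = 0%N by elim: n j => [|n IHn] [|j] //=.
rewrite ups_D0 ups_cat !num_nseq ups_U0 /= !mul0n !mul1n !add0n subn0.
case def_r: (s - (L + t + 1))%N => [|r]; first by repeat (case: ifP => ?); lia.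
by rewrite ups_cat ups_U0 ups_D0 !num_nseq /=; repeat (case: ifP => ?); lia.
Qed.

Lemma baseS i : base i.+1 = (base i + period)%N.
Proof. by rewrite /base mulSn addnC. Qed.

Definition orbit (x : seq bool) (r : nat) : nat := iter r (ups (family_word x)) 0.

Lemma split_at (x : seq bool) i : (i < size x)%N ->
  x = take i x ++ nth false x i :: drop i.+1 x.
Proof. by move=> lt_i; rewrite -drop_nth // cat_take_drop. Qed.

Lemma orbit1 x : orbit x 1 = (base 0 + t)%N.
Proof.
rewrite -[orbit x 1]/(ups (family_word x) 0) /family_word (ups_cat start_word).
rewrite num_start /=.
have ups_start m w : ups (nseq m U ++ D :: w) 0 = m by elim: m => //= m ->.
by rewrite ups_start.
Qed.

(** The i-th visit to a block: the orbit is alive as long as all earlier bits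
    are true. It then hits the letter on which the two contents of the block
    differ, and the gap turns the resulting shift by 1 into a shift by L, which
    makes it land either on the critical letter of the next block or before
    that block. A dead orbit jumps over the block and stays dead. *)
Lemma orbit_block x i : (i < size x)%N ->
  orbit x (2 * i).+1 = (base i + t - if all id (take i x) then 0 else L)%N ->
  orbit x (2 * i).+2 =
    (base i + 2 * L +
     if all id (take i x) then t + nth false x i else 0)%N.
Proof.
move=> lt_i orbit_i.
rewrite -[orbit x _.+2]/(ups (family_word x) (orbit x (2 * i).+1)) {}orbit_i.
case: ifP => all_i.
  have sz_take : size (take i x) = i by rewrite size_takel // ltnW.
  have := @ups_family_block (take i x) (nth false x i) (drop i.+1 x) t lt_tL.
  by rewrite -split_at // sz_take subn0 blk_t => ->; lia.
case: i lt_i all_i => [|i] lt_i all_i; first by rewrite take0 in all_i.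
have lt_i' := ltnW lt_i.
have sz_take : size (take i x) = i by rewrite size_takel // ltnW.
rewrite (_ : (base i.+1 + t - L = base i + L + (2 * L).+1)%N); last first.
  by rewrite baseS /period; lia.
have := @ups_family_gap (take i x) (nth false x i) (drop i.+1 x) (2 * L).+1.
rewrite -split_at // sz_take => ->; last by lia.
by rewrite baseS /period; repeat (case: ifP => ?); lia.
Qed.

(** The two possible images of factor t and the image of a dead position all lie
    in the first run of D of the gap, except for the larger image of factor t,
    which lies just behind the run of U that follows. *)
Lemma orbit_gap x i : (i < size x)%N ->
  orbit x (2 * i).+2 =
    (base i + 2 * L + if all id (take i x) then t + nth false x i else 0)%N ->
  orbit x (2 * i.+1).+1 =
    (base i.+1 + t - if all id (take i.+1 x) then 0 else L)%N.
Proof.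
move=> lt_i orbit_i; rewrite mulnS.
rewrite -[orbit x _.+1]/(ups (family_word x) (orbit x (2 * i).+2)) {}orbit_i.
have sz_take : size (take i x) = i by rewrite size_takel // ltnW.
set y := if _ then _ else _.
have le_y : (y <= t.+1)%N by rewrite /y; case: ifP => _ //; case: nth; lia.
have def_y : (y == t.+1) = all id (take i.+1 x).
  rewrite (take_nth false) // all_rcons /= andbC /y; case: ifP => _ //=.
  by case: nth; apply/eqP; lia.
have := @ups_family_gap (take i x) (nth false x i) (drop i.+1 x) (L + y).
rewrite -split_at // sz_take -[(base i + L + _)%N]addnA addnA.
rewrite (_ : (base i + L + (L + y) = base i + 2 * L + y)%N); last by lia.
move=> ->; last by lia.
rewrite -def_y baseS /period; case: eqP => ? ; repeat (case: ifP => ?); lia.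
Qed.

Lemma orbit_family x i : (i <= size x)%N ->
  orbit x (2 * i).+1 = (base i + t - if all id (take i x) then 0 else L)%N.
Proof.
elim: i => [|i IHi] lt_i; first by rewrite take0 subn0 orbit1.
by apply: orbit_gap => //; apply: orbit_block => //; apply: IHi; apply: ltnW.
Qed.

Lemma orbit_even x i : (i < size x)%N ->
  orbit x (2 * i).+2 =
    (base i + 2 * L + if all id (take i x) then t + nth false x i else 0)%N.
Proof. by move=> lt_i; apply/orbit_block/orbit_family/ltnW. Qed.

Lemma orbit_homo x : {homo orbit x : r r' / (r <= r')%N}.
Proof.
apply: homo_leq => // [r|r]; first exact: leq_trans.
by rewrite /orbit iterSr; apply: iter_mono => //; apply: ups_mono.
Qed.

Section LastBit.
Variable x : seq bool.
Let m := size x.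
Let x0 := rcons x false.
Let x1 := rcons x true.

(** The two contents of a block have the same numbers of letters. *)
Lemma ups_last j : (j < base m)%N || (base m + L <= j)%N ->
  ups (family_word x1) j = ups (family_word x0) j.
Proof.
have family_last b : family_word (rcons x b) = (start_word ++ blocks_word x) ++
    bits_code (blk b) ++ gap_word ++ nseq (2 * L) D.
  by rewrite /family_word /blocks_word map_rcons flatten_rcons /= -!catA.
have num_pre : num D (start_word ++ blocks_word x) = base m.
  by rewrite num_cat num_start num_blocks.
rewrite !family_last !(ups_cat (start_word ++ _)) num_pre; case: ltnP => //= le_j.
rewrite !(ups_cat (bits_code _)) !num_bits_code !size_blk => le_j'.
by have -> : (j - base m < L)%N = false by lia.
Qed.

(** The orbit needs 2m + 1 steps to reach the last block, or the letter before
    it from which it jumps over it. *)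
Lemma orbit_before_last r : (r <= (2 * m).+1)%N -> orbit x1 r = orbit x0 r.
Proof.
elim: r => // r IHr lt_r; rewrite /orbit !iterS -!/(orbit _ _) IHr ?(ltnW lt_r) //.
apply: ups_last; apply/orP; left.
apply: (@leq_ltn_trans (orbit x0 (2 * m))); first exact: orbit_homo.
rewrite /m; case def_m: (size x) => [|m']; first by [].
rewrite (_ : (2 * m'.+1 = (2 * m').+2)%N) ?mulnS //.
rewrite orbit_even ?size_rcons ?def_m; last by lia.
by rewrite baseS /period; case: ifP => _; last lia; case: nth; lia.
Qed.

Lemma orbit_last_block b :
  orbit (rcons x b) (2 * m).+2 = (base m + 2 * L + if all id x then t + b else 0)%N.
Proof.
rewrite orbit_even ?size_rcons // -cats1 take_size_cat // nth_cat.
by rewrite ltnn subnn.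
Qed.

Lemma sum_orbit_dead n : ~~ all id x ->
  (\sum_(r < n) orbit x1 r.+1 = \sum_(r < n) orbit x0 r.+1)%N.
Proof.
move=> not_all; suff orbit_eq r : orbit x1 r = orbit x0 r by apply: eq_bigr.
elim: r => // r IHr; have [le_r|lt_r] := leqP r.+1 (2 * m).+1.
  exact: orbit_before_last.
rewrite /orbit !iterS -!/(orbit _ _) IHr; apply: ups_last.
move: lt_r; rewrite ltnS leq_eqVlt => /predU1P[<-|lt_r].
  rewrite /x0 orbit_family ?size_rcons // -cats1 take_size_cat // (negbTE not_all).
  by have : (0 < base m)%N by []; lia.
apply/orP; right; apply: (@leq_trans (orbit _ (2 * m).+2)); last exact: orbit_homo.
by rewrite orbit_last_block; lia.
Qed.

(** After the last block the orbit with bit true stays ahead, f being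
    monotone. *)
Lemma sum_orbit_alive n : all id x -> ((2 * m).+1 < n)%N ->
  (\sum_(r < n) orbit x0 r.+1 < \sum_(r < n) orbit x1 r.+1)%N.
Proof.
move=> all_x lt_n; suff orbit_le r : (orbit x0 r <= orbit x1 r)%N.
  pose F x' r := orbit x' r.+1.
  apply: (@ltn_sum_at n _ (F x0) (F x1) lt_n) => [r|]; first exact: orbit_le.
  by rewrite /F !orbit_last_block all_x; lia.
elim: r => // r IHr; have [le_r|lt_r] := leqP r.+1 (2 * m).+1.
  by rewrite orbit_before_last.
move: lt_r; rewrite ltnS leq_eqVlt => /predU1P[<-|lt_r].
  by rewrite !orbit_last_block all_x; lia.
apply: leq_trans (ups_mono _ IHr) _; rewrite -ups_last //.
apply/orP; right; apply: (@leq_trans (orbit _ (2 * m).+2)); last exact: orbit_homo.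
by rewrite orbit_last_block; lia.
Qed.

End LastBit.

Lemma num_family y x : num y (family_word x) = (2 * L + 1 + size x * period)%N.
Proof.
by rewrite num_cat num_start num_cat num_blocks num_nseq; case: y => /=; lia.
Qed.

Lemma area_stat_family x : let n := (2 * L + 1 + size x * period)%N in
  area_stat (zeta_inv (family_word x)) =
  (n.+1 * n)%N%:Z - (\sum_(r < n.+1) orbit x r.+1)%N%:Z.
Proof.
move=> n; have dyck_x := dyck_family x.
have := area_stat_zeta_preimage dyck_x; rewrite num_family -/n zeta_invE // => <-.
by rewrite addrK.
Qed.

(** By the two preceding cases, the difference over the last bit is supported
    by the all-true word. *)
Lemma alt_area_stat_family m :
  alt_sum m.+1 (fun x => area_stat (zeta_inv (family_word x))) <> 0.
Proof.
rewrite /= alt_sum_all_true => [|x sz_x nt_x].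
  rewrite !area_stat_family !size_rcons size_nseq.
  have := @sum_orbit_alive (nseq m true) (2 * L + 1 + m.+1 * period).+1.
  rewrite all_nseq orbT size_nseq => /(_ isT); rewrite mulSn.
  by move: (\sum_(r < _) _)%N (\sum_(r < _) _)%N => a b; rewrite /period; nia.
rewrite !area_stat_family !size_rcons sum_orbit_dead ?subrr //.
apply: contra_notN nt_x => all_x; rewrite -sz_x; apply/all_pred1P.
by apply: sub_all all_x => -[].
Qed.

End Family.

Theorem theorem1p4 :
  ~ exists T : seq letter -> option (seq letter),
      WRP T /\ forall P : seq letter, dyck P -> T P = Some (zeta_inv P).
Proof.
case=> T [[p def_T] T_zeta_inv].
have [L [g [g' [neq_gg' indist_gg']]]] :=
  pigeonhole_indist (@presentation_machine p) (code := bit_code) ltac:(by case).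
have [t lt_tL neq_t] : exists2 t, (t < L)%N & nth false g t != nth false g' t.
  have [/forallP eq_gg'|/forallPn[t neq_t]] := boolP [forall t, tnth g t == tnth g' t].
    by case/eqP: neq_gg'; apply: eq_from_tnth => t; apply/eqP.
  by exists t => //; rewrite -!tnth_nth.
(* The bit true stands for the content that has UD at t. *)
wlog [g_t g'_t] : g g' neq_gg' indist_gg' neq_t /
    nth false g t = true /\ nth false g' t = false.
  case g_t: (nth false g t) neq_t; case g'_t: (nth false g' t) => // _ IH.
    by apply: (IH g g'); rewrite ?g_t ?g'_t.
  apply: (IH g' g); rewrite ?g_t ?g'_t 1?eq_sym // => j q.
  by have [-> ->] := indist_gg' j q.
pose blk b := if b then tval g else tval g'.
have size_blk b : size (blk b) = L by case: b; rewrite size_tuple.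
have blk_t b : nth false (blk b) t = b by case: b.
(* A pair of atoms has at most m positions: m + 1 blocks suffice. *)
pose m := (2 * \max_(c : copy p) arity c)%N.
apply: (alt_area_stat_family lt_tL size_blk blk_t (m := m)).
have <- := @alt_area_stat_output p m.+1 (start_word L t) (nseq (2 * L) D)
  (gap_word L t) (fun b => bits_code (blk b)) _ _ indist_gg'.
- apply: eq_alt_sum => x _; congr area_stat.
  have := def_T (family_word L t blk x).
  rewrite T_zeta_inv ?dyck_family // /wrp_map; case: ifP => // _.
  by case.
- by move=> c c'; rewrite ltnS /m mul2n -addnn leq_add // leq_bigmax.
by rewrite !size_num !num_bits_code !size_blk.
Qed.
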